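(* For every integer $k\geq1$, let $\mathcal{T}_k$ be the class of graphs of treewidth at most $k$. Then the maximum over $G\in\mathcal{T}_k$ of each of the arboricity $\operatorname{a}(G)$, the outerthickness $\operatorname{ot}(G)$, the geometric outerthickness $\operatorname{got}(G)$ and the geometric arboricity $\operatorname{ga}(G)$ equals $k$.
   Context: Graphs are finite, simple and undirected. A $k$-tree is defined recursively: $K_{k+1}$ is a $k$-tree, and if $G$ has a vertex $v$ whose neighbourhood is a $k$-clique and $G-v$ is a $k$-tree then $G$ is a $k$-tree. The treewidth of $G$ is the minimum $k$ such that $G$ is a spanning subgraph of a $k$-tree. The arboricity $\operatorname{a}(G)$ (resp. outerthickness $\operatorname{ot}(G)$) is the minimum number of forests (resp. outerplanar subgraphs) whose edge sets partition $E(G)$. A geometric drawing of $G$ maps vertices injectively to points of $\mathbb{R}^2$ and each edge to the straight segment between its endpoints, with no edge containing a vertex other than its endpoints. Two edges cross if they intersect at a point other than a common endpoint. A subdrawing is noncrossing if no two of its edges cross; it is outer if moreover all its vertices lie on the boundary of the unbounded component of the complement of the drawing. The geometric arboricity $\operatorname{ga}(G)$ (resp. geometric outerthickness $\operatorname{got}(G)$) is the minimum $t$ such that some geometric drawing of $G$ has its edges partitioned into $t$ classes each of which forms a noncrossing forest (resp. an outer noncrossing subdrawing). *)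

(* Defs.v *)
From HB Require Import structures.
From mathcomp Require Import all_boot all_order all_algebra.
From mathcomp Require Import all_classical all_reals all_analysis.

Set Implicit Arguments.
Unset Strict Implicit.
Unset Printing Implicit Defensive.
Import Order.TTheory GRing.Theory Num.Theory.
Import numFieldTopology.Exports numFieldNormedType.Exports.

Definition is_minimum (P : nat -> Prop) (n : nat) : Prop :=
  P n /\ forall m, P m -> n <= m.

Definition is_maximum (P : nat -> Prop) (n : nat) : Prop :=
  P n /\ forall m, P m -> m <= n.

Record sgraph (T : finType) := SGraph {
  adj :> rel T;
  adj_sym : symmetric adj;
  adj_irrefl : irreflexive adj
}.

(* An edge xy is the two-element set {x, y}. *)
Definition edges (T : finType) (G : sgraph T) : {set {set T}} :=
  [set [set p.1; p.2] | p : T * T & G p.1 p.2]%SET.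

(* The spanning subgraph on T with edge set F; singletons in F are ignored. *)
Definition edge_adj (T : finType) (F : {set {set T}}) : rel T :=
  fun x y => (x != y) && ([set x; y]%SET \in F).

Lemma edge_adj_sym (T : finType) (F : {set {set T}}) : symmetric (edge_adj F).
Proof. by move=> x y; rewrite /edge_adj eq_sym finset.setUC. Qed.

Lemma edge_adj_irrefl (T : finType) (F : {set {set T}}) :
  irreflexive (edge_adj F).
Proof. by move=> x; rewrite /edge_adj eqxx. Qed.

Definition graph_of_edges (T : finType) (F : {set {set T}}) : sgraph T :=
  SGraph (edge_adj_sym F) (edge_adj_irrefl F).

Definition is_clique (T : finType) (G : sgraph T) (A : {set T}) : Prop :=
  {in A &, forall x y, x != y -> G x y}.

(* [ktree_on k G A]: the subgraph of G induced by A is a k-tree. *)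
Inductive ktree_on (k : nat) (T : finType) (G : sgraph T) : {set T} -> Prop :=
| ktree_base (A : {set T}) : #|A| = k.+1 -> is_clique G A -> ktree_on k G A
| ktree_step (A : {set T}) v :
    v \in A ->
    #|[set w in A | G v w]%SET| = k ->
    is_clique G [set w in A | G v w]%SET ->
    ktree_on k G (A :\ v)%SET ->
    ktree_on k G A.

Definition is_ktree (k : nat) (T : finType) (G : sgraph T) : Prop :=
  ktree_on k G [set: T]%SET.

Definition is_treewidth (T : finType) (G : sgraph T) : nat -> Prop :=
  is_minimum (fun k => exists H : sgraph T, is_ktree k H /\ subrel G H).

Definition treewidth_le (k : nat) (T : finType) (G : sgraph T) : Prop :=
  exists w, is_treewidth G w /\ w <= k.

Definition is_forest (T : finType) (G : sgraph T) : Prop :=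
  forall c : seq T, uniq c -> cycle G c -> size c <= 2.

Section Plane.
Variable R : realType.
Local Open Scope ring_scope.
Local Open Scope classical_set_scope.

Definition plane := 'rV[R]_2.

Definition segment (a b : plane) : set plane :=
  [set a + t *: (b - a) | t in `[0, 1]].

Definition is_arc (a b : plane) (A : set plane) : Prop :=
  exists g : R -> plane,
    [/\ {within `[0, 1], continuous g},
        {in `[0, 1] &, injective g},
        g 0 = a, g 1 = b & A = g @` `[0, 1]].

Definition boundary (A : set plane) : set plane :=
  closure A `&` closure (~` A).

Definition unbounded_component (D C : set plane) : Prop :=
  (exists2 x, (~` D) x & C = connected_component (~` D) x) /\
  ~ bounded_set C.

Section Drawings.
Variable T : finType.

(* [pos] places the vertices and [curve] gives the point set of each edge;
   the values of [curve] outside the edges of the graph are irrelevant. *)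
Definition is_drawing (G : sgraph T) (pos : T -> plane)
    (curve : {set T} -> set plane) : Prop :=
  [/\ injective pos,
      forall x y, G x y -> is_arc (pos x) (pos y) (curve [set x; y]%SET) &
      forall x y z, G x y -> curve [set x; y]%SET (pos z) -> z = x \/ z = y].

Definition is_geometric_drawing (G : sgraph T) (pos : T -> plane)
    (curve : {set T} -> set plane) : Prop :=
  is_drawing G pos curve /\
  forall x y, G x y -> curve [set x; y]%SET = segment (pos x) (pos y).

Definition edges_cross (pos : T -> plane) (curve : {set T} -> set plane)
    (e f : {set T}) : Prop :=
  exists z, [/\ curve e z, curve f z &
    ~ exists v, [/\ v \in e, v \in f & pos v = z]].

Definition noncrossing (F : {set {set T}}) (pos : T -> plane)
    (curve : {set T} -> set plane) : Prop :=
  {in F &, forall e f, e != f -> ~ edges_cross pos curve e f}.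

Definition drawn_points (V : {set T}) (F : {set {set T}}) (pos : T -> plane)
    (curve : {set T} -> set plane) : set plane :=
  [set z | (exists2 v, v \in V & pos v = z) \/
           (exists2 e, e \in F & curve e z)].

Definition outer (V : {set T}) (F : {set {set T}}) (pos : T -> plane)
    (curve : {set T} -> set plane) : Prop :=
  exists2 C, unbounded_component (drawn_points V F pos curve) C &
    forall v, v \in V -> boundary C (pos v).

Definition is_outerplanar (G : sgraph T) : Prop :=
  exists pos curve, [/\ is_drawing G pos curve,
    noncrossing (edges G) pos curve & outer [set: T]%SET (edges G) pos curve].

(* The blocks of a [finset.partition] are nonempty; allowing empty classes
   would not change any of the minima below. *)

Definition is_arboricity (G : sgraph T) : nat -> Prop :=
  is_minimum (fun t => exists P : {set {set {set T}}},
    [/\ finset.partition P (edges G), #|P| = t &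
        forall F, F \in P -> is_forest (graph_of_edges F)]).

Definition is_outerthickness (G : sgraph T) : nat -> Prop :=
  is_minimum (fun t => exists P : {set {set {set T}}},
    [/\ finset.partition P (edges G), #|P| = t &
        forall F, F \in P -> is_outerplanar (graph_of_edges F)]).

Definition is_geometric_arboricity (G : sgraph T) : nat -> Prop :=
  is_minimum (fun t => exists pos curve, is_geometric_drawing G pos curve /\
    exists P : {set {set {set T}}},
    [/\ finset.partition P (edges G), #|P| = t &
        forall F, F \in P ->
          is_forest (graph_of_edges F) /\ noncrossing F pos curve]).

(* A class F of edges forms the subdrawing whose vertices are the endpoints
   of the edges in F, that is, [finset.cover F]. *)
Definition is_geometric_outerthickness (G : sgraph T) : nat -> Prop :=
  is_minimum (fun t => exists pos curve, is_geometric_drawing G pos curve /\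
    exists P : {set {set {set T}}},
    [/\ finset.partition P (edges G), #|P| = t &
        forall F, F \in P ->
          noncrossing F pos curve /\ outer (finset.cover F) F pos curve]).

End Drawings.
End Plane.

(* [is_par G n] reads "the parameter of G is n".  The first conjunct says that
   the parameter is defined on the whole class. *)
Definition max_over_treewidth_le (k : nat)
    (is_par : forall T : finType, sgraph T -> nat -> Prop) (m : nat) : Prop :=
  (forall (T : finType) (G : sgraph T),
     treewidth_le k G -> exists n, is_par T G n) /\
  is_maximum (fun n => exists (T : finType) (G : sgraph T),
    treewidth_le k G /\ is_par T G n) m.

(* Main.v *)
(* Upper bounds.  Order the vertices of a k-tree so that each vertex t has a bag of at
   most k earlier neighbours.  With u the last of them, the bag of t is contained in
   the bag of u with the entry in some slot i replaced by u; colour each edge from t to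
   its bag by the slot used.  Draw t very close to u, slightly beyond u on the ray
   from the replaced vertex: then t is a leaf of every colour class when it is added,
   and the edge of colour j at t either is short (j = i) or runs along the edge of
   colour j from u to its bag.  So all k classes are noncrossing straight-line
   forests, and the complement of such a forest is connected and dense.

   Lower bounds.  If n is large, any partition of the edges of K_{k,n} into fewer than k
   classes has a class containing K_{2,3}, by pigeonholing twice.  This is not a forest.
   It has no drawing with all vertices on one face either: joining the three vertices
   of degree 2 to a point of the face would draw K_{3,3} without crossings between
   nonadjacent edges, except that the vertices need not be accessible from the face by
   arcs; since the last bit of a new edge only has to avoid the old edges not adjacent
   to it, a short segment suffices.  Such a drawing of K_{3,3} is excluded by a mod 2
   winding number count, which needs nothing but continuity of the edges. *)

Require Import Defs.
From mathcomp Require Import all_boot all_order all_algebra.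
From mathcomp Require Import all_classical all_reals all_analysis.
From mathcomp Require Import ring lra zify.

Set Implicit Arguments.
Unset Strict Implicit.
Unset Printing Implicit Defensive.
Import Order.TTheory GRing.Theory Num.Theory.
Import numFieldTopology.Exports numFieldNormedType.Exports.
Local Open Scope classical_set_scope.
Local Open Scope ring_scope.

(** * Nonplanarity of K_{3,3} *)

Lemma addb_glue (a b c d e f g : bool) : a (+) b (+) c (+) d = false ->
  b (+) e (+) f (+) g = false -> a (+) e (+) (c (+) f) (+) (d (+) g) = false.
Proof. by case: a; case: b; case: c; case: d; case: e; case: f; case: g. Qed.

Lemma addb_glue' (a b c d e f g : bool) : a (+) b (+) c (+) d = false ->
  e (+) f (+) d (+) g = false -> (a (+) e) (+) (b (+) f) (+) c (+) g = false.
Proof. by case: a; case: b; case: c; case: d; case: e; case: f; case: g. Qed.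

Lemma addb_move (a b c d e f g h : bool) :
  a (+) b (+) (c (+) e (+) f) (+) (d (+) g (+) h) = false ->
  (a (+) b) (+) (c (+) d) = (e (+) f) (+) (g (+) h).
Proof.
by case: a; case: b; case: c; case: d; case: e; case: f; case: g; case: h.
Qed.

Lemma addb_sum4 (a b c d e f g h : bool) :
  (a (+) b) (+) (c (+) d) = (e (+) f) (+) (g (+) h) ->
  exists q : int, (a + b + c + d + e + f + g + h)%N%:Z = 2%:Z * q.
Proof.
move=> H; exists ((a + b + c + d + e + f + g + h)./2)%:Z.
by move: H; case: a; case: b; case: c; case: d; case: e; case: f; case: g; case: h.
Qed.

Section Winding.
Variable R : realType.
Implicit Types (u v w x y : plane R) (s t : seq (plane R)) (m : R).

Lemma norm_lt_coord m u :
  (`|u| < m) = (`|u ord0 ord0| < m) && (`|u ord0 ord_max| < m).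
Proof.
rewrite {1}/Num.Def.normr /= mx_normrE.
apply/idP/idP => [h|/andP[h0 h1]].
  by apply/andP; split; apply: le_lt_trans h;
     [apply: (le_bigmax _ (fun ij => `|u ij.1 ij.2|) (ord0, ord0))
     |apply: (le_bigmax _ (fun ij => `|u ij.1 ij.2|) (ord0, ord_max))].
apply: bigmax_lt => [|[i j] _ /=]; first exact: le_lt_trans h0.
rewrite (ord1 i); case: j => -[|[|//]] lj.
  by rewrite (_ : Ordinal lj = ord0) //; apply: val_inj.
by rewrite (_ : Ordinal lj = ord_max) //; apply: val_inj.
Qed.

Lemma norm_ge_coord m u :
  (m <= `|u|) = (m <= `|u ord0 ord0|) || (m <= `|u ord0 ord_max|).
Proof. by rewrite !leNgt norm_lt_coord negb_and. Qed.

Lemma coordB u v i j : (u - v) i j = u i j - v i j.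
Proof. by rewrite !mxE. Qed.

(** Ties on the axis are broken by the first coordinate, so that exactly one of [u] and [- u] is
    upper whenever [u] is nonzero. *)
Definition upper u : bool :=
  (0 < u ord0 ord_max) || ((u ord0 ord_max == 0) && (0 < u ord0 ord0)).

(* For close vectors far from 0, tells whether the segment from u to v crosses
   the positive half-axis. *)
Definition axis_cross u v : bool := (upper u (+) upper v) && (0 < u ord0 ord0).

Lemma upper_neq u v : upper u != upper v ->
  (0 <= u ord0 ord_max /\ v ord0 ord_max <= 0) \/
  (u ord0 ord_max <= 0 /\ 0 <= v ord0 ord_max).
Proof.
rewrite /upper; case: (ltgtP 0 (u ord0 ord_max)); case: (ltgtP 0 (v ord0 ord_max)) => //=;
  by move=> *; (left + right); split; lra.
Qed.

(** The second coordinates of [u] and [v] have opposite weak signs, so that of [w] is below [m] in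
    absolute value; the norm is the maximum of the coordinates. *)
Lemma near_axis_far m u v w : upper u != upper v ->
  `|u - v| < m -> `|u - w| < m -> `|v - w| < m -> m <= `|w| ->
  m <= `|w ord0 ord0|.
Proof.
move=> /upper_neq huv; rewrite !norm_lt_coord !coordB !ltr_norml.
move=> /andP[_ /andP[a1 a2]] /andP[_ /andP[b1 b2]] /andP[_ /andP[c1 c2]].
rewrite norm_ge_coord => /orP[//|]; rewrite leNgt ltr_norml => /negP[].
by case: huv => -[h1 h2]; apply/andP; split; lra.
Qed.

Lemma near_axis_same_side m u v w w' : upper u != upper v ->
  `|u - v| < m -> `|u - w| < m -> `|v - w| < m ->
  `|u - w'| < m -> `|v - w'| < m -> `|w - w'| < m ->
  m <= `|w| -> m <= `|w'| -> (0 < w ord0 ord0) = (0 < w' ord0 ord0).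
Proof.
move=> huv uv uw vw uw' vw' ww' mw mw'.
have := near_axis_far huv uv uw vw mw; have := near_axis_far huv uv uw' vw' mw'.
move: ww'; rewrite norm_lt_coord coordB !ler_normr ltr_norml => /andP[/andP[a b] _].
by move=> /orP[] h /orP[] h'; apply/idP/idP => h''; lra.
Qed.

(** If two corners differ in [upper], all first coordinates have the same sign, so either every side
    contributes 0 or each contributes the difference of its [upper] bits, which cancels around the
    square. Otherwise every term is 0. *)
Lemma axis_cross_square m u00 u01 u10 u11 :
  m <= `|u00| -> m <= `|u01| -> m <= `|u10| -> m <= `|u11| ->
  `|u00 - u01| < m / 2 -> `|u00 - u10| < m / 2 -> `|u01 - u11| < m / 2 ->
  `|u10 - u11| < m / 2 ->
  axis_cross u00 u10 (+) axis_cross u01 u11 (+) axis_cross u00 u01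
    (+) axis_cross u10 u11 = false.
Proof.
move=> n00 n01 n10 n11 d1 d2 d3 d4.
have H2 u v w : `|u - v| < m / 2 -> `|v - w| < m / 2 -> `|u - w| < m.
  move=> uv vw; rewrite (le_lt_trans (ler_distD v _ _)) //; lra.
have H1 u v : `|u - v| < m / 2 -> `|u - v| < m.
  by move=> uv; rewrite (lt_le_trans uv)//; have := normr_ge0 (u - v); lra.
have e1 := H1 _ _ d1; have e2 := H1 _ _ d2; have e3 := H1 _ _ d3; have e4 := H1 _ _ d4.
have e5 := H2 _ _ _ d1 d3; have e6 : `|u10 - u01| < m.
  by apply: H2 d1; rewrite distrC.
have m0 : 0 < m by apply: le_lt_trans e1.
pose l := [:: u00; u01; u10; u11].
have dl u v : u \in l -> v \in l -> `|u - v| < m.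
  rewrite !inE => /or4P[] /eqP-> /or4P[] /eqP->; rewrite ?subrr ?normr0 //;
  by rewrite // distrC.
have nl u : u \in l -> m <= `|u| by rewrite !inE => /or4P[] /eqP->.
have same u v w w' : u \in l -> v \in l -> w \in l -> w' \in l ->
    upper u != upper v -> (0 < w ord0 ord0) = (0 < w' ord0 ord0).
  by move=> *; apply: (@near_axis_same_side m u v); rewrite ?dl ?nl.
have i00 : u00 \in l by rewrite !inE eqxx.
have i01 : u01 \in l by rewrite !inE eqxx ?orbT.
have i10 : u10 \in l by rewrite !inE eqxx ?orbT.
have i11 : u11 \in l by rewrite !inE eqxx ?orbT.
have [s1|s1] := eqVneq (upper u00) (upper u01); last first.
  rewrite /axis_cross (same _ _ _ u00 i00 i01 i01 i00 s1).
  rewrite (same _ _ _ u00 i00 i01 i10 i00 s1).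
  by case: (0 < _); case: (upper u00) s1; case: (upper u01); case: (upper u10); case: (upper u11).
have [s2|s2] := eqVneq (upper u00) (upper u10); last first.
  rewrite /axis_cross (same _ _ _ u00 i00 i10 i01 i00 s2).
  rewrite (same _ _ _ u00 i00 i10 i10 i00 s2).
  by case: (0 < _); case: (upper u00) s2 s1; case: (upper u01); case: (upper u10);
    case: (upper u11).
have [s3|s3] := eqVneq (upper u00) (upper u11); last first.
  rewrite /axis_cross (same _ _ _ u00 i00 i11 i01 i00 s3).
  rewrite (same _ _ _ u00 i00 i11 i10 i00 s3).
  by case: (0 < _); case: (upper u00) s3 s2 s1; case: (upper u01); case: (upper u10);
    case: (upper u11).
by rewrite /axis_cross -s1 -s2 -s3 addbb.
Qed.

Lemma upperN u : u != 0 -> upper (- u) = ~~ upper u.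
Proof.
move=> u0; rewrite /upper !mxE oppr_gt0 oppr_eq0 oppr_gt0.
case: (ltgtP 0 (u ord0 ord_max)) => //= e1.
case: (ltgtP 0 (u ord0 ord0)) => //= e0.
suff : `|u| == 0 by rewrite normr_eq0 (negbTE u0).
rewrite eq_le normr_ge0 andbT; apply/ler_addgt0Pl => e e0'.
by rewrite addr0 ltW // norm_lt_coord -e0 -e1 !normr0 e0'.
Qed.

(** Negation exchanges the two half-axes, and a step crosses one of them exactly when [upper]
    changes. *)
Lemma axis_crossN m u v : 0 < m -> m <= `|u| -> m <= `|v| -> `|u - v| < m ->
  axis_cross (- u) (- v) = axis_cross u v (+) upper u (+) upper v.
Proof.
move=> m0 mu mv uv.
have nz w : m <= `|w| -> w != 0 by rewrite -normr_gt0; apply: lt_le_trans.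
rewrite /axis_cross !upperN ?nz//.
have [e|e] := eqVneq (upper u) (upper v); first by rewrite e; case: (upper v).
have : m <= `|u ord0 ord0|.
  by apply: (near_axis_far e uv _ _ mu); rewrite ?subrr ?normr0// distrC.
rewrite mxE ler_normr oppr_gt0 => h.
suff -> : (u ord0 ord0 < 0) = ~~ (0 < u ord0 ord0).
  by case: (upper u) e; case: (upper v) => // _; case: (0 < _).
by case/orP: h => h; case: ltgtP; lra.
Qed.

(** A discrete winding number mod 2 of the chain as seen from [w]; [coturn] is its analogue for the
    opposite vector. *)
Fixpoint turn w x s : bool :=
  if s is y :: s' then axis_cross (x - w) (y - w) (+) turn w y s' else false.

Fixpoint coturn w x s : bool :=
  if s is y :: s' then axis_cross (w - x) (w - y) (+) coturn w y s' else false.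

Definition step (e : R) : rel (plane R) := fun x y => `|x - y| < e.

Definition apart m s t := forall x y, x \in s -> y \in t -> m <= `|x - y|.

Lemma coturnE m w x s : 0 < m -> apart m (x :: s) [:: w] -> path (step m) x s ->
  coturn w x s = turn w x s (+) upper (x - w) (+) upper (last x s - w).
Proof.
move=> m0; elim: s x => [|y s IH] x /= ap; first by case: (upper _).
move=> /andP[xy p]; rewrite IH//; last first.
  by move=> a b ha; apply: ap; rewrite in_cons ha orbT.
rewrite -(opprB x) -(opprB y) (@axis_crossN m)//.
- by case: (axis_cross _ _); case: (turn _ _ _); case: (upper _); case: (upper _); case: (upper _).
- by apply: ap; rewrite !inE ?eqxx.
- by apply: ap; rewrite !inE ?eqxx ?orbT.
- by rewrite opprB addrA subrK.
Qed.

(** The difference vector is a function on the grid of pairs of chain points, and its crossings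
    cancel around each unit square. One row of squares is glued here; [turn_grid] stacks the
    rows. *)
Lemma turn_strip m x x' y t : apart m [:: x; x'] (y :: t) ->
  step (m / 2) x x' -> path (step (m / 2)) y t ->
  axis_cross (x - y) (x' - y) (+) axis_cross (x - last y t) (x' - last y t)
    (+) coturn x y t (+) coturn x' y t = false.
Proof.
elim: t y => [|z t IH] y ap xx' /=; first by rewrite addbb.
move=> /andP[yz p].
have := IH z _ xx' p; move=> -/(_ _)/=.
have ap' : apart m [:: x; x'] (z :: t).
  by move=> a b ha hb; apply: ap => //; rewrite in_cons hb orbT.
move=> /(_ ap').
have := @axis_cross_square m (x - y) (x - z) (x' - y) (x' - z).
do 4 (move=> /(_ _)/wrap[]; first by apply: ap; rewrite !inE eqxx ?orbT).
have dx a b c : a - b - (a - c) = c - b :> plane R by rewrite opprB addrC addrA subrK.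
have dy a b c : a - b - (c - b) = a - c :> plane R by rewrite opprB addrA subrK.
do 4 (move=> /(_ _)/wrap[]; first by rewrite ?dx ?dy // distrC).
exact: addb_glue.
Qed.

Lemma turn_grid m x s y t : 0 < m -> apart m (x :: s) (y :: t) ->
  path (step (m / 2)) x s -> path (step (m / 2)) y t ->
  turn y x s (+) turn (last y t) x s (+) coturn x y t (+) coturn (last x s) y t
  = false.
Proof.
move=> m0 + + pt; elim: s x => [|x' s IH] x ap /=; first by rewrite addbb.
move=> /andP[xx' p].
have ap' : apart m (x' :: s) (y :: t).
  by move=> a b ha; apply: ap; rewrite in_cons ha orbT.
have := IH x' ap' p.
have : apart m [:: x; x'] (y :: t).
  by move=> a b; rewrite !inE => ha; apply: ap; rewrite !inE; case/orP: ha => ->; rewrite ?orbT.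
move=> /turn_strip/(_ xx' pt); exact: addb_glue'.
Qed.

(** The sum along the boundary of the grid vanishes. Two of its sides are [coturn] terms; rewriting
    them as turns by [coturnE] produces the endpoint bits on the right. *)
Lemma turn_disjoint m x s y t : 0 < m -> apart m (x :: s) (y :: t) ->
  path (step (m / 2)) x s -> path (step (m / 2)) y t ->
  (turn y x s (+) turn (last y t) x s) (+) (turn x y t (+) turn (last x s) y t)
  = (upper (y - x) (+) upper (last y t - x))
    (+) (upper (y - last x s) (+) upper (last y t - last x s)).
Proof.
move=> m0 ap ps pt; have := turn_grid m0 ap ps pt.
have pt' : path (step m) y t.
  by apply: sub_path pt => a b /= /lt_le_trans; apply; lra.
have ap' z : z \in x :: s -> apart m (y :: t) [:: z].
  by move=> zs a b ha; rewrite inE => /eqP->; rewrite distrC; exact: ap.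
rewrite (@coturnE m x)// ?(@coturnE m (last x s))//.
- exact: addb_move.
- by apply: ap'; exact: mem_last.
- by apply: ap'; rewrite mem_head.
Qed.

(* Summing turn_disjoint over the 18 pairs of independent edges of K_{3,3},
   every turn cancels, and what remains is the number of pairs {Y j, Y l},
   each of which contributes upper (Y j - Y l) + upper (Y l - Y j) = 1. *)
Lemma no_K33_chains m (X Y : 'I_3 -> plane R) (c : 'I_3 -> 'I_3 -> seq (plane R)) :
  0 < m -> (forall i j, path (step (m / 2)) (X i) (c i j)) ->
  (forall i j, last (X i) (c i j) = Y j) ->
  (forall i j k l, i != k -> j != l -> apart m (X i :: c i j) (X k :: c k l)) ->
  injective Y -> False.
Proof.
move=> m0 pc lc ap injY.
have H i k j l (ik : i != k) (jl : j != l) :=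
  addb_sum4 (turn_disjoint m0 (ap i j k l ik jl) (pc i j) (pc k l)).
have upN j l : j != l -> upper (Y l - Y j) = ~~ upper (Y j - Y l).
  move=> jl; rewrite -opprB upperN// subr_eq0; apply: contra_neq jl; exact: injY.
pose i0 : 'I_3 := ord0; pose i1 : 'I_3 := inord 1; pose i2 : 'I_3 := inord 2.
have n01 : i0 != i1 by rewrite -val_eqE /= inordK.
have n02 : i0 != i2 by rewrite -val_eqE /= inordK.
have n12 : i1 != i2 by rewrite -val_eqE /= !inordK.
have n10 : i1 != i0 by rewrite eq_sym.
have n20 : i2 != i0 by rewrite eq_sym.
have n21 : i2 != i1 by rewrite eq_sym.
have u1 := upN _ _ n01; have u2 := upN _ _ n02; have u3 := upN _ _ n12.
have q (i k : 'I_3) (ik : i != k) := conj (H i k _ _ ik n01) (conj (H i k _ _ ik n02)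
  (conj (H i k _ _ ik n10) (conj (H i k _ _ ik n12) (conj (H i k _ _ ik n20)
  (H i k _ _ ik n21))))).
have nb (b : bool) : (~~ b)%:Z = 1 - (b : nat)%:Z by case: b.
move: (q _ _ n01) (q _ _ n02) (q _ _ n12).
rewrite !lc u1 u2 u3 !PoszD !nb {q H upN n01 n02 n12 n10 n20 n21 u1 u2 u3}.
move=> [[q1 e1][[q2 e2][[q3 e3][[q4 e4][[q5 e5][q6 e6]]]]]].
move=> [[q7 e7][[q8 e8][[q9 e9][[q10 e10][[q11 e11][q12 e12]]]]]].
move=> [[q13 e13][[q14 e14][[q15 e15][[q16 e16][[q17 e17][q18 e18]]]]]].
clear -e1 e2 e3 e4 e5 e6 e7 e8 e9 e10 e11 e12 e13 e14 e15 e16 e17 e18.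
(* Every turn and every [upper] bit becomes an arbitrary integer: only parities enter the final
   contradiction. *)
repeat match goal with H : context [Posz (nat_of_bool ?b)] |- _ =>
  move: (Posz (nat_of_bool b)) e1 e2 e3 e4 e5 e6 e7 e8 e9 e10 e11 e12 e13 e14 e15 e16 e17 e18
  => ? e1 e2 e3 e4 e5 e6 e7 e8 e9 e10 e11 e12 e13 e14 e15 e16 e17 e18 end.
lia.
Qed.
End Winding.

(** * Chains, positive distance and faces of closed sets *)

Section Separation.
Variable R : realType.
Implicit Types (x y z a b : plane R) (A B D S K : set (plane R)).

Lemma ball_planeE x (r : R) y : ball x r y = (`|x - y| < r) :> Prop.
Proof. by rewrite -ball_normE. Qed.

Lemma segment_continuous a b : continuous (fun t : R => a + t *: (b - a)).
Proof.
move=> t; apply: cvgD; first exact: cvg_cst.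
by apply: cvgZr_tmp; exact: cvg_id.
Qed.

Lemma connected_segment a b : connected (segment a b).
Proof.
apply: connected_continuous_connected; first exact: segment_connected.
exact/continuous_subspaceT/segment_continuous.
Qed.

Lemma compact_segment a b : compact (segment a b).
Proof.
apply: continuous_compact; last exact: segment_compact.
exact/continuous_subspaceT/segment_continuous.
Qed.

Lemma segmentl a b : segment a b a.
Proof. by exists 0; rewrite /= ?in_itv/= ?lexx ?ler01// scale0r addr0. Qed.

Lemma segmentr a b : segment a b b.
Proof. by exists 1; rewrite /= ?in_itv/= ?lexx ?ler01// scale1r addrC subrK. Qed.

Lemma segmentC a b : segment a b = segment b a.
Proof.
have sub u v : segment u v `<=` segment v u.
  move=> _ [t /= + <-]; rewrite in_itv/= => /andP[t0 t1].
  exists (1 - t); first by rewrite /= in_itv/=; lra.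
  by apply/rowP => i; rewrite !mxE; ring.
by apply/seteqP; split; exact: sub.
Qed.

Lemma star_connected x A : (forall y, A y -> segment x y `<=` A) -> connected A.
Proof.
move=> sA; have -> : A = \bigcup_(y in A) segment x y.
  apply/seteqP; split => [y Ay|z [y Ay]]; last exact: sA.
  by exists y => //; exact: segmentr.
apply: bigcup_connected => [|y _]; last exact: connected_segment.
by exists x => y _; exact: segmentl.
Qed.

Lemma segment_dist a b z : segment a b z -> `|a - z| <= `|a - b|.
Proof.
move=> [t /= + <-]; rewrite in_itv/= => /andP[t0 t1].
rewrite opprD addrA subrr sub0r normrN normrZ distrC ger0_norm//.
by rewrite ler_piMl.
Qed.

Lemma connected_ball x (r : R) : connected (ball x r).
Proof.
apply: (@star_connected x) => y + z /segment_dist; rewrite !ball_planeE => xy xz.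
exact: le_lt_trans xy.
Qed.

(** The set of points reachable by such chains is open and closed in [A], since a point of [A]
    within [e] of a reachable point is reachable. *)
Lemma connected_chain A x y (e : R) : connected A -> 0 < e -> A x -> A y ->
  exists s : seq (plane R),
    [/\ path (step e) x s, last x s = y & forall z, z \in x :: s -> A z].
Proof.
move=> cA e0 Ax Ay.
pose B := [set y | exists s : seq (plane R),
    [/\ path (step e) x s, last x s = y & forall z, z \in x :: s -> A z]].
have BA : B `<=` A by move=> _ [s [_ <- sA]]; apply: sA; exact: mem_last.
have ext u v : B u -> A v -> `|u - v| < e -> B v.
  move=> [s [ps ls sA]] Av uv; exists (rcons s v).
  rewrite rcons_path last_rcons ps ls; split => // z.
  by rewrite -rcons_cons mem_rcons inE => /orP[/eqP->//|]; exact: sA.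
suff BeA : B = A by rewrite -BeA in Ay.
apply: cA.
- by exists x, [::]; split => // z; rewrite inE => /eqP->.
- exists (\bigcup_(u in B) ball u e); first by apply: bigcup_open => u _; exact: ball_open.
  apply/seteqP; split => [u Bu|v [Av [u Bu]]].
    by split; [exact: BA|exists u => //; exact: ballxx].
  by rewrite ball_planeE; exact: ext.
- exists (~` \bigcup_(u in A `\` B) ball u e).
    by apply: open_closedC; apply: bigcup_open => u _; exact: ball_open.
  apply/seteqP; split => [v Bv|v [Av nv]].
    split; first exact: BA.
    by move=> [u [Au nBu]]; rewrite ball_planeE distrC => /(ext _ _ Bv Au).
  by apply: contrapT => nBv; apply: nv; exists v => //; exact: ballxx.
Qed.

Definition far A B := exists2 m : R, 0 < m & forall x y, A x -> B y -> m <= `|x - y|.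

Lemma farC A B : far A B -> far B A.
Proof. by move=> [m m0 H]; exists m => // x y Bx Ay; rewrite distrC; exact: H. Qed.

Lemma farUl A B D : far A D -> far B D -> far (A `|` B) D.
Proof.
move=> [m m0 mA] [n n0 nB]; exists (Num.min m n); first by rewrite lt_min m0.
by move=> x y [Ax|Bx] Dy; rewrite ge_min; apply/orP; [left; exact: mA|right; exact: nB].
Qed.

Lemma farS A B A' B' : A `<=` A' -> B `<=` B' -> far A' B' -> far A B.
Proof. by move=> sA sB [m m0 H]; exists m => // x y /sA ? /sB; exact: H. Qed.

Lemma far_point_closed x B : closed B -> ~ B x ->
  exists2 r : R, 0 < r & far (ball x r) B.
Proof.
move=> cB nBx; have : nbhs x (~` B) by apply: open_nbhs_nbhs; split => //; exact: closed_openC.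
move=> /nbhs_ballP[e /= e0 He]; exists (e / 2); first by rewrite divr_gt0.
exists (e / 2) => [|y z]; first by rewrite divr_gt0.
rewrite ball_planeE => xy Bz; rewrite leNgt; apply/negP => yz; apply: (He z) Bz.
rewrite ball_planeE; apply: le_lt_trans (ler_distD y _ _) _; lra.
Qed.

Lemma far_compact_closed A B : compact A -> closed B -> A `&` B = set0 -> far A B.
Proof.
move=> /compact_near_coveringP cA cB AB0.
have : \forall m \near (0 : R)^'+, A `<=` [set x | forall y, B y -> m <= `|x - y|].
  apply: cA => x Ax.
  have [|r r0 [m m0 H]] := @far_point_closed x _ cB.
    by move=> Bx; have : (A `&` B) x by []; rewrite AB0.
  exists (ball x r, [set m' | m' <= m]) => /=.
    by split; [exact: nbhsx_ballx|exact: nbhs_right_le].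
  by move=> [y m'] /= [xy mm'] z Bz; apply: le_trans mm' _; exact: H.
move=> /(filterI (@nbhs_right_gt R 0))/filter_ex[m [m0 H]].
by exists m => // x y Ax; exact: H.
Qed.

(** Replaces an arc inside a face. The points linked to [x] in this way form an open and closed part
    of the component, because a small ball far from [D] can always be attached to [K]. *)
Lemma component_far D x y : closed D -> connected_component (~` D) x y ->
  exists K, [/\ connected K, K x, K y & far K D].
Proof.
move=> cD Cxy; have nDx : (~` D) x.
  by apply: contrapT => nx; move: Cxy; rewrite connected_component_out.
pose C := connected_component (~` D) x.
pose P := [set y | exists K, [/\ connected K, K x, K y & far K D]].
have open_link u : (~` D) u -> exists2 r : R, 0 < r & forall v w,
    ball u r v -> ball u r w -> P v -> P w.
  move=> nDu; have [r r0 rD] := far_point_closed cD nDu.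
  exists r => // v w uv uw [K [cK Kx Kv KD]]; exists (K `|` ball u r); split.
  - by apply: connectedU => //; [exists v|exact: connected_ball].
  - by left.
  - by right.
  - exact: farUl.
suff : C `&` P = C by move=> /seteqP[_ /(_ y Cxy)[]].
apply: (@component_connected _ (~` D) x).
- exists x; split; first exact: connected_component_refl.
  have [r r0 rD] := far_point_closed cD nDx.
  by exists (ball x r); split; [exact: connected_ball|exact: ballxx|exact: ballxx|].
- exists (P `&` ~` D)^°; first exact: open_interior.
  apply/seteqP; split => [u [Cu Pu]|u [Cu /interior_subset[Pu _]]]; last by split.
  split => //; have nDu := connected_component_sub Cu.
  have [r r0 H] := open_link u nDu.
  have oD : nbhs u (~` D) by apply: open_nbhs_nbhs; split => //; exact: closed_openC.
  apply: filterS (filterI (nbhsx_ballx u r r0) oD) => v [uv Dv]; split => //.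
  by apply: H uv Pu; exact: ballxx.
- exists (closure (C `&` P)); first exact: closed_closure.
  apply/seteqP; split => [u CPu|u [Cu cu]]; first by split; [case: CPu|exact: subset_closure].
  split => //; have [r r0 H] := open_link u (connected_component_sub Cu).
  have [v [[Cv Pv] uv]] := cu _ (nbhsx_ballx u r r0).
  by apply: H uv _ Pv; exact: ballxx.
Qed.

(* A strong form of the nonplanarity of K_{3,3}: adjacent edges may intersect. *)
Lemma no_K33 (X Y : 'I_3 -> plane R) (E : 'I_3 -> 'I_3 -> set (plane R)) :
  (forall i j, [/\ connected (E i j), E i j (X i) & E i j (Y j)]) ->
  (forall i j k l, i != k -> j != l -> far (E i j) (E k l)) -> injective Y -> False.
Proof.
move=> conE farE injY.
have : \forall m \near (0:R)^'+, forall q : 'I_3 * 'I_3 * ('I_3 * 'I_3),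
    q.1.1 != q.2.1 -> q.1.2 != q.2.2 -> forall x y, E q.1.1 q.1.2 x ->
      E q.2.1 q.2.2 y -> m <= `|x - y|.
  apply: filter_forall => -[[i j] [k l]] /=.
  have [->|ik] := eqVneq i k; first exact: nearW.
  have [->|jl] := eqVneq j l; first exact: nearW.
  have [m m0 H] := farE i j k l ik jl.
  near=> m' => _ _ x y Ex Ey; apply: le_trans (H x y Ex Ey).
  by near: m'; exact: nbhs_right_le.
move=> /(filterI (@nbhs_right_gt R 0))/filter_ex[m [m0 H]].
have ch i j : {s : seq (plane R) |
    [/\ path (step (m / 2)) (X i) s, last (X i) s = Y j & forall z, z \in X i :: s -> E i j z]}.
  apply: cid; have [c Ei Ej] := conE i j; apply: connected_chain => //.
  by rewrite divr_gt0.
apply: (@no_K33_chains R m X Y (fun i j => sval (ch i j))) => //.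
- by move=> i j; case: (svalP (ch i j)).
- by move=> i j; case: (svalP (ch i j)).
- move=> i j k l ik jl x y.
  have [_ _ /(_ x) Hx] := svalP (ch i j); have [_ _ /(_ y) Hy] := svalP (ch k l).
  by move=> /Hx Ex /Hy Ey; exact: (H ((i, j), (k, l))).
Unshelve. all: by end_near. Qed.

(** The point [x] of the face becomes a third vertex beside [a] and [b], joined to every [p i], and
    [no_K33] applies. *)
Lemma no_outer_K23 a b (p : 'I_3 -> plane R) (A B : 'I_3 -> set (plane R)) D x :
  (forall i, [/\ compact (A i), connected (A i), A i a, A i (p i) & A i `<=` D]) ->
  (forall i, [/\ compact (B i), connected (B i), B i b, B i (p i) & B i `<=` D]) ->
  (forall i j, i != j -> A i `&` B j = set0) ->
  (forall i j, i != j -> ~ A i (p j) /\ ~ B i (p j)) -> injective p ->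
  closed D -> (forall i, closure (connected_component (~` D) x) (p i)) -> False.
Proof.
move=> HA HB AB ABp injp cD clp.
have ccl (S : set (plane R)) : compact S -> closed S.
  by apply: compact_closed; exact: norm_hausdorff.
(* The spoke stays far from [D] until it is close to [p i], and then takes a whole ball around
   [p i]. This ball may meet [A i] and [B i], which are adjacent to the spoke. *)
have spoke i : exists S, [/\ connected S, S x, S (p i) &
    forall j, i != j -> far S (A j) /\ far S (B j)].
  have nAB j : i != j -> ~ (A j `|` B j) (p i).
    by rewrite eq_sym => ij [|]; have [] := ABp _ _ ij.
  have : \forall r \near (0:R)^'+, forall j, i != j -> far (ball (p i) r) (A j `|` B j).
    apply: filter_forall => j; have [->|ij] := eqVneq i j; first exact: nearW.
    have [|r r0 rf] := far_point_closed _ (nAB j ij).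
      by apply: closedU; apply: ccl; [have [] := HA j|have [] := HB j].
    near=> r' => _; apply: farS rf => //; apply: le_ball.
    by near: r'; exact: nbhs_right_le.
  move=> /(filterI (@nbhs_right_gt R 0))/filter_ex[r [r0 far_r]].
  have [c [Cc pc]] := clp i _ (nbhsx_ballx (p i) r r0).
  have [K [cK Kx Kc KD]] := component_far cD Cc.
  exists (K `|` ball (p i) r); split; [|by left|by right; exact: ballxx|].
    by apply: connectedU => //; [exists c|exact: connected_ball].
  move=> j ij; have [_ _ _ _ AD] := HA j; have [_ _ _ _ BD] := HB j.
  split; apply: farUl; try by apply: farS KD.
    by apply: farS (far_r j ij) => // z; left.
  by apply: farS (far_r j ij) => // z; right.
pose S i := sval (cid (spoke i)).
have SP i : [/\ connected (S i), S i x, S i (p i) &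
    forall j, i != j -> far (S i) (A j) /\ far (S i) (B j)] := svalP (cid (spoke i)).
pose X (i : 'I_3) := if val i is 0 then a else if val i is 1 then b else x.
pose E (i : 'I_3) := if val i is 0 then A else if val i is 1 then B else S.
apply: (@no_K33 X p E) => //.
- move=> i j; rewrite /E /X; case: (val i) => [|[|_]].
  + by have [] := HA j.
  + by have [] := HB j.
  + by have [] := SP j.
- have farAB i j : i != j -> far (A i) (B j).
    move=> ij; apply: far_compact_closed (AB i j ij); first by have [] := HA i.
    by apply: ccl; have [] := HB j.
  have farSA i j : i != j -> far (S i) (A j).
    by have [_ _ _ h] := SP i; move=> /h[].
  have farSB i j : i != j -> far (S i) (B j).
    by have [_ _ _ h] := SP i; move=> /h[].
  move=> i j k l; rewrite -val_eqE /E.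
  case: i k => -[|[|[|//]]] ? [[|[|[|//]]] ?] //= _ jl; auto;
    by apply: farC; rewrite eq_sym in jl; auto.
Unshelve. all: by end_near. Qed.
End Separation.

(** * Perfect elimination orders of k-trees *)

Section BagSystems.
Local Open Scope nat_scope.

(* The virtual vertices 0, ..., k-1, which carry no edge, give every vertex t >= k
   exactly k slots, so that the edges from t to its bag can be coloured by the slots
   and the initial clique needs no separate treatment. *)
Definition bag_system (k N : nat) (bag : nat -> nat -> nat) : Prop :=
  (forall j, j < k -> bag k j = j) /\
  forall t, k < t < N -> exists u i, [/\ k <= u < t, i < k &
    forall j, j < k -> bag t j = if j == i then u else bag u j].

Lemma bag_systemW k M N bag : M <= N -> bag_system k N bag -> bag_system k M bag.
Proof.
by move=> MN [b0 b]; split => // t /andP[kt tM]; apply: b; rewrite kt (leq_trans tM).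
Qed.

Lemma bag_lt k N bag t j : bag_system k N bag -> k <= t < N -> j < k ->
  bag t j < t.
Proof.
move=> [b0 b] + jk; have [n tn] := ubnP t.
elim: n t tn => // n IH t tn /andP[kt tN].
have [->|tk] := eqVneq t k; first by rewrite b0.
have [|u [i [/andP[ku ut] ik ->//]]] := b t; first by rewrite tN; lia.
case: eqP => // _; apply: (ltn_trans _ ut); apply: IH; lia.
Qed.

Lemma bag_inj k N bag t i j : bag_system k N bag -> k <= t < N -> i < k -> j < k ->
  bag t i = bag t j -> i = j.
Proof.
move=> bs + ik jk; have [b0 b] := bs; have [n tn] := ubnP t.
elim: n t tn => // n IH t tn /andP[kt tN].
have [->|tk] := eqVneq t k; first by rewrite !b0.
have [|u [l [/andP[ku ut] lk E]]] := b t; first by rewrite tN; lia.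
have ltu j' : j' < k -> bag u j' < u by apply: (bag_lt bs); lia.
rewrite !E//; case: eqP => [->|_]; case: eqP => [->|_] // e.
- by have := ltu j jk; rewrite -e ltnn.
- by have := ltu i ik; rewrite e ltnn.
- apply: IH e; lia.
Qed.

Section Layout.
Variables (T : finType) (H : sgraph T) (k : nat).
Hypothesis k_gt0 : 0 < k.
Implicit Types (s : seq T) (bag : nat -> nat -> nat).

(** The vertex [x] has the number [k + index x s], after the virtual vertices. A slot may also hold
    a non-neighbour. *)
Definition bag_layout s bag := bag_system k (k + size s) bag /\
  forall x y, x \in s -> y \in s -> H x y -> index x s < index y s ->
    exists2 j, j < k & bag (k + index y s) j = k + index x s.

(** Take [u] last in [N]. The other vertices of the clique lie in the bag of [u] and number at most
    [k - 1], so they leave some slot [i] free. *)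
Lemma free_slot s bag (N : {set T}) : bag_layout s bag -> 0 < size s ->
  is_clique H N -> #|N| <= k -> {subset N <= s} ->
  exists u i, [/\ k <= u < k + size s, i < k & forall w, w \in N ->
    k + index w s = u \/ exists j, [/\ j < k, j != i & bag u j = k + index w s]].
Proof.
move=> [bs lay] s0 clN cardN Ns.
have [N0|[w0 w0N]] := set_0Vmem N.
  (* Any [u] works when [N] is empty; the first real vertex has number [k]. *)
  by exists k, 0; split; [lia|by []|move=> w; rewrite N0 inE].
pose u := [arg max_(w > w0 in N) index w s].
have [uN umax] : u \in N /\ forall w, w \in N -> index w s <= index u s.
  by rewrite /u; case: arg_maxnP => // v vN vmax; split.
pose f w : 'I_k := odflt (Ordinal k_gt0)
  [pick j : 'I_k | bag (k + index u s) j == k + index w s].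
have fP w : w \in N :\ u -> bag (k + index u s) (f w) = k + index w s.
  rewrite !inE => /andP[wu wN]; rewrite /f; case: pickP => [j /eqP//|none].
  have [||j jk bj] := lay w u (Ns _ wN) (Ns _ uN).
  - exact: clN.
  - rewrite ltn_neqAle umax// andbT; apply: contra_neq wu => e.
    by rewrite -(nth_index w0 (Ns _ wN)) e nth_index// Ns.
  - by have := none (Ordinal jk); rewrite /= bj eqxx.
have : #|f @: (N :\ u)| < #|'I_k|.
  rewrite card_ord; apply: leq_ltn_trans (leq_imset_card _ _) _.
  by move: cardN; rewrite (cardsD1 u) uN.
move=> /ltn_eqF; have := cardsT 'I_k => <- ne.
have [i iN] : exists i, i \notin f @: (N :\ u).
  apply/existsP; apply: contraFT ne; rewrite negb_exists => /forallP all_in.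
  apply/eqP; congr #|pred_of_set _|; apply/setP => i; rewrite !inE.
  by have := all_in i; rewrite negbK.
exists (k + index u s), i; split => //.
  by rewrite leq_addr ltn_add2l index_mem Ns.
move=> w wN; have [->|wu] := eqVneq w u; [by left|right].
have wNu : w \in N :\ u by rewrite !inE wu.
exists (f w); split => //; last exact: fP.
by rewrite val_eqE; apply: contraNneq iN => <-; exact: imset_f.
Qed.

(** The new vertex inherits the bag of [u] with slot [i] given to [u]; by [free_slot] this still
    covers all its earlier neighbours. *)
Lemma layout_rcons s bag v : bag_layout s bag -> v \notin s ->
  is_clique H [set w in s | H v w] -> #|[set w in s | H v w]| <= k ->
  exists bag', bag_layout (rcons s v) bag'.
Proof.
move=> [bs lay] vs clN cardN.
have ids x : x \in s -> index x (rcons s v) = index x s.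
  by move=> xs; rewrite -cats1 index_cat xs.
have idv : index v (rcons s v) = size s.
  by rewrite -cats1 index_cat (negbTE vs) /= eqxx addn0.
have [s0|s0] := posnP (size s).
  exists (fun _ j => j); split => [|x y]; last first.
    by rewrite (size0nil s0) !inE => /eqP-> /eqP->; rewrite adj_irrefl.
  by split => // t; rewrite size_rcons s0; lia.
have [|u [i [/andP[ku us] ik ui]]] := @free_slot s bag _ (conj bs lay) s0 clN cardN.
  by move=> w; rewrite inE => /andP[].
pose bag' t j := if t == k + size s then (if j == i then u else bag u j) else bag t j.
have old t : t < k + size s -> bag' t = bag t.
  by move=> ts; apply/funext => j; rewrite /bag' ltn_eqF.
exists bag'; split.
  have [b0 b] := bs; split => [j jk|t]; first by rewrite old ?b0//; lia.
  rewrite size_rcons addnS ltnS => /andP[kt]; rewrite leq_eqVlt => /orP[/eqP->|ts].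
    exists u, i; split => // [|j jk]; first by rewrite ku.
    by rewrite (old u)// /bag' eqxx.
  have [|u' [i' [/andP[ku' ut'] ik' e]]] := b t; first by rewrite kt.
  exists u', i'; split => // [|j jk]; first by rewrite ku'.
  by rewrite !old ?e// (ltn_trans ut').
move=> x y; rewrite !mem_rcons !inE => /orP[/eqP->|xs] /orP[/eqP->|ys].
- by rewrite adj_irrefl.
- by rewrite idv (ids _ ys) => _; rewrite ltnNge index_size.
- rewrite idv (ids _ xs) adj_sym => Hvx _.
  have [|e|[j [jk ji bj]]] := ui x; first by rewrite inE xs.
    by exists i => //; rewrite /bag' !eqxx.
  by exists j => //; rewrite /bag' eqxx (negbTE ji).
- rewrite !ids// => Hxy /(lay _ _ xs ys Hxy)[j jk bj]; exists j => //.
  by rewrite old// ltn_add2l index_mem.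
Qed.

(** The clique is built vertex by vertex: each vertex has at most [k] earlier neighbours, and they
    form a clique. *)
Lemma clique_layout s : uniq s -> is_clique H [set x in s] -> size s <= k.+1 ->
  exists bag, bag_layout s bag.
Proof.
elim/last_ind: s => [_ _ _|s v IH].
  by exists (fun _ j => j); split => //; split => // t; rewrite addn0; lia.
rewrite rcons_uniq size_rcons ltnS => /andP[vs us] cl sk.
have cl' (A : {set T}) : {subset A <= rcons s v} -> is_clique H A.
  by move=> As x y /As xs /As ys; apply: cl; rewrite inE.
have [||bag lay] := IH us.
- by apply: cl' => x; rewrite inE mem_rcons inE => ->; rewrite orbT.
- exact: leqW.
apply: (layout_rcons lay vs).
- by apply: cl' => x; rewrite inE mem_rcons inE => /andP[-> _]; rewrite orbT.
- apply: leq_trans sk; apply: leq_trans (card_size s); apply: subset_leq_card.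
  by apply/fintype.subsetP => x; rewrite inE => /andP[].
Qed.

(** Since slots may hold non-neighbours, a [w]-tree with [w <= k] fits directly into [k] slots. *)
Lemma ktree_layout w (A : {set T}) : w <= k -> ktree_on w H A ->
  exists s bag, [/\ uniq s, s =i A & bag_layout s bag].
Proof.
move=> wk; elim=> {A} [A cA clA|A v vA cN clN _ [s [bag [us sA lay]]]].
  have [|||bag lay] := @clique_layout (enum A).
  - exact: enum_uniq.
  - by move=> x y; rewrite !inE !mem_enum; exact: clA.
  - by rewrite -cardE cA.
  by exists (enum A), bag; split => //; [exact: enum_uniq|move=> x; rewrite mem_enum].
have NE : [set w in s | H v w] = [set w in A | H v w].
  apply/setP => x; rewrite !inE sA !inE; case: eqP => [->|//].
  by rewrite adj_irrefl !andbF.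
have vs : v \notin s by rewrite sA !inE eqxx.
have [||bag' lay'] := @layout_rcons s bag v lay vs.
- by rewrite NE.
- by rewrite NE cN.
exists (rcons s v), bag'; split => //; first by rewrite rcons_uniq vs.
move=> x; rewrite mem_rcons inE sA !inE; case: eqP => [->|//]; by rewrite vA.
Qed.
End Layout.
End BagSystems.

(** * Drawing a k-tree *)

Section Drawing.
Variable R : realType.
Implicit Types (p : nat -> plane R).

(** Twice the signed area of the triangle; the sign tells on which side of the line [a b] the point
    [c] lies. *)
Definition orient (a b c : plane R) : R :=
  (b ord0 ord0 - a ord0 ord0) * (c ord0 ord_max - a ord0 ord_max) -
  (b ord0 ord_max - a ord0 ord_max) * (c ord0 ord0 - a ord0 ord0).

Lemma orient_rot (a b c : plane R) : orient a b c = orient b c a.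
Proof. by rewrite /orient; ring. Qed.

Lemma orientC (a b c : plane R) : orient a b c = - orient a c b.
Proof. by rewrite /orient; ring. Qed.

Lemma near0_sg (a c : R) : a != 0 ->
  \forall e \near 0^'+, Num.sg (a + e * c) = Num.sg a.
Proof.
move=> a0; have c0 : 0 < `|a| / (`|c| + 1).
  by rewrite divr_gt0 ?normr_gt0// ltr_wpDl.
near=> e.
have e0 : 0 < e by near: e; exact: nbhs_right_gt.
have : e < `|a| / (`|c| + 1) by near: e; exact: nbhs_right_lt.
rewrite ltr_pdivlMr ?ltr_wpDl// => h.
have ec : `|e * c| < `|a|.
  by apply: le_lt_trans h; rewrite normrM (gtr0_norm e0) ler_pM2l//; lra.
move: ec; rewrite ltr_norml => /andP[h1 h2].
move: a0; rewrite neq_lt => /orP[]s.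
  by move: h1 h2; rewrite ltr0_norm// => h1 h2; rewrite !ltr0_sg//; lra.
by move: h1 h2; rewrite gtr0_norm// => h1 h2; rewrite !gtr0_sg//; lra.
Unshelve. all: by end_near. Qed.

Definition general_position (N : nat) p := forall a b c : nat,
  (a < N)%N -> (b < N)%N -> (c < N)%N ->
  a != b -> b != c -> a != c -> orient (p a) (p b) (p c) != 0.

(** Move from [p u] by a short step along the ray coming from [p x], tilted slightly off that line.
    Lines missing [p u] do not separate the two points, and lines through [p u] have the new point
    on the side away from [p x]. *)
Lemma ex_point_beyond (N : nat) p (u x : nat) : general_position N p ->
  (u < N)%N -> (x < N)%N -> u != x -> p u != p x ->
  exists v, [/\ forall a b : nat, (a < N)%N -> (b < N)%N -> a != b -> a != u -> b != u ->
                  Num.sg (orient (p a) (p b) v) = Num.sg (orient (p a) (p b) (p u)),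
     forall b : nat, (b < N)%N -> b != u -> b != x ->
       Num.sg (orient (p u) (p b) v) = - Num.sg (orient (p u) (p b) (p x)) &
     orient (p u) (p x) v != 0].
Proof.
move=> gp uN xN ux pux.
pose cross (v w : plane R) : R := v ord0 ord0 * w ord0 ord_max - v ord0 ord_max * w ord0 ord0.
pose d0 : plane R := p u - p x.
(* The direction [d0] turned by a right angle: the tilt that keeps the new point off the line
   through [p u] and [p x]. *)
pose e : plane R := \row_j (if j == ord0 then - d0 ord0 ord_max else d0 ord0 ord0).
have crossD v w w' t : cross v (w + t *: w') = cross v w + t * cross v w'.
  by rewrite /cross !mxE; ring.
have orientE a b d t : orient a b (p u + t *: d) = orient a b (p u) + t * cross (b - a) d.
  by rewrite /orient /cross !mxE; ring.
have orientE' b d t : orient (p u) b (p u + t *: d) = t * cross (b - p u) d.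
  by rewrite /orient /cross !mxE; ring.
have crossN b : cross (b - p u) d0 = - orient (p u) b (p x).
  by rewrite /orient /cross /d0 !mxE; ring.
have crosse : cross (p x - p u) e != 0.
  have -> : cross (p x - p u) e = - ((d0 ord0 ord0) ^+ 2 + (d0 ord0 ord_max) ^+ 2).
    by rewrite /cross /e /d0 !mxE /=; ring.
  rewrite oppr_eq0 paddr_eq0 ?sqr_ge0// !sqrf_eq0; apply: contra pux => /andP[/eqP h0 /eqP h1].
  rewrite -subr_eq0; apply/eqP/rowP => -[[|[|//]] lj]; rewrite [RHS]mxE.
    by rewrite -[RHS]h0; congr (_ _ _); exact: val_inj.
  by rewrite -[RHS]h1; congr (_ _ _); exact: val_inj.
(* The tilt [t] is fixed first, for the lines through [p u]; the length [s] of the step is chosen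
   afterwards, for the other lines. *)
have : \forall t \near 0^'+, forall b : 'I_N, val b != u -> val b != x ->
    Num.sg (cross (p b - p u) (d0 + t *: e)) = - Num.sg (orient (p u) (p b) (p x)).
  apply: filter_forall => b; have [->|bu] := eqVneq (val b) u; first exact: nearW.
  have [->|bx] := eqVneq (val b) x; first exact: nearW.
  have nz : cross (p b - p u) d0 != 0 by rewrite crossN oppr_eq0 gp// eq_sym.
  by apply: filterS (near0_sg (cross (p b - p u) e) nz) => t h _ _; rewrite crossD h crossN sgrN.
move=> /(filterI (@nbhs_right_gt R 0))/filter_ex[t [t0 Ht]].
have : \forall s \near 0^'+, forall q : 'I_N * 'I_N, val q.1 != val q.2 ->
    val q.1 != u -> val q.2 != u ->
    Num.sg (orient (p q.1) (p q.2) (p u + s *: (d0 + t *: e))) =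
    Num.sg (orient (p q.1) (p q.2) (p u)).
  apply: filter_forall => -[a b] /=.
  have [->|ab] := eqVneq (val a) (val b); first exact: nearW.
  have [->|au] := eqVneq (val a) u; first exact: nearW.
  have [->|bu] := eqVneq (val b) u; first exact: nearW.
  have nz : orient (p a) (p b) (p u) != 0 by rewrite gp.
  apply: filterS (near0_sg (cross (p b - p a) (d0 + t *: e)) nz) => s h _ _ _.
  by rewrite orientE h.
move=> /(filterI (@nbhs_right_gt R 0))/filter_ex[s [s0 Hs]].
exists (p u + s *: (d0 + t *: e)); split.
- by move=> a b aN bN ab au bu; exact: (Hs (Ordinal aN, Ordinal bN)).
- by move=> b bN bu bx; rewrite orientE' sgrM gtr0_sg// mul1r (Ht (Ordinal bN)).
- have o0 : orient (p u) (p x) (p x) = 0 by rewrite /orient; ring.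
  rewrite orientE' crossD crossN o0 oppr0 add0r.
  by rewrite mulf_eq0 gt_eqF//= mulf_eq0 gt_eqF.
Qed.

Definition apart_segments (a b c d : plane R) :=
  Num.sg (orient a b c) = Num.sg (orient a b d) \/
  Num.sg (orient c d a) = Num.sg (orient c d b).

Lemma apart_segmentsC (a b c d : plane R) : apart_segments a b c d -> apart_segments c d a b.
Proof. by case=> h; [right|left]. Qed.

(** The line [u v] separates the segments, which touch it only at [u] and at [v]. The proof is a
    sign count in the area identity [e1] of the four points. *)
Lemma apart_segments_opposite (u v b s : plane R) :
  Num.sg (orient u v b) = - Num.sg (orient u v s) -> orient u v b != 0 ->
  apart_segments s u v b.
Proof.
move=> opp nz; rewrite /apart_segments.
have e1 : orient v b s = orient u v b - orient u v s + orient s u b by rewrite /orient; ring.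
have e2 : orient s u v = orient u v s by rewrite /orient; ring.
have e3 : orient v b u = orient u v b by rewrite /orient; ring.
rewrite e1 e2 e3.
move: nz opp; rewrite neq_lt => /orP[]h.
  rewrite (ltr0_sg h) => /eqP; rewrite eq_sym eqr_oppLR opprK sgr_cp0 => h'.
  have [h2|h2] := ltP 0 (orient s u b); [by left; rewrite !gtr0_sg|].
  by right; rewrite !ltr0_sg//; lra.
rewrite (gtr0_sg h) => /eqP; rewrite eq_sym eqr_oppLR sgr_cp0 => h'.
have [h2|h2] := ltP (orient s u b) 0; [by left; rewrite !ltr0_sg|].
by right; rewrite !gtr0_sg//; lra.
Qed.

(* Write b_i(u) for bag u i.  In guarded, a vertex s joined to u = b_j(s) by an edge of
   colour j lies on the other side of the line u b_i(u) than b_j(u), for every i <> j.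
   Hence a point placed slightly beyond u on the ray from b_i(u) can be joined to
   b_j(u) without crossing the edge s u. *)
Record good_drawing (k N : nat) (bag : nat -> nat -> nat) p : Prop := GoodDrawing {
  injective_points : forall a b : nat, (a < N)%N -> (b < N)%N -> a != b -> p a != p b;
  in_general_position : general_position N p;
  noncrossing_classes : forall j s t : nat, (j < k)%N -> (k <= s < t)%N -> (t < N)%N ->
    [\/ bag s j = bag t j, s = bag t j |
        apart_segments (p s) (p (bag s j)) (p t) (p (bag t j))];
  guarded : forall s i j : nat, (k <= s < N)%N -> (i < k)%N -> (j < k)%N -> i != j ->
    (k <= bag s j)%N ->
    Num.sg (orient (p (bag s j)) (p (bag (bag s j) i)) (p s)) =
    - Num.sg (orient (p (bag s j)) (p (bag (bag s j) i)) (p (bag (bag s j) j)))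
}.

(** On a parabola the orientation is a Vandermonde product. *)
Lemma parabola_general_position N :
  general_position N (fun n => \row_j (if j == ord0 then n%:R else n%:R ^+ 2)).
Proof.
move=> a b c _ _ _ ab bc ac.
have -> : orient (\row_j (if j == ord0 then a%:R else a%:R ^+ 2))
    (\row_j (if j == ord0 then b%:R else b%:R ^+ 2))
    (\row_j (if j == ord0 then c%:R else c%:R ^+ 2)) =
    (b%:R - a%:R) * (c%:R - a%:R) * (c%:R - b%:R) :> R.
  by rewrite /orient !mxE /=; ring.
by rewrite !mulf_neq0// subr_eq0 eqr_nat eq_sym.
Qed.

(** At most one vertex has a bag, and that bag is entirely virtual, so the last two conditions are
    vacuous. *)
Lemma good_drawing_base k N bag : (N <= k.+1)%N -> bag_system k N bag ->
  exists p, good_drawing k N bag p.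
Proof.
move=> Nk [b0 _]; exists (fun n => \row_j (if j == ord0 then n%:R else n%:R ^+ 2)); split.
- move=> a b _ _ ab; apply/eqP => /(congr1 (fun v : plane R => v ord0 ord0)).
  by rewrite !mxE /= => /eqP; rewrite eqr_nat (negbTE ab).
- exact: parabola_general_position.
- by move=> j s t _ ? ?; lia.
- move=> s i j /andP[ks sN] _ jk _.
  have -> : s = k by lia.
  by rewrite b0//; lia.
Qed.

Lemma good_drawing_step k N bag p : (1 < N)%N -> (k < N)%N -> bag_system k N.+1 bag ->
  good_drawing k N bag p -> exists p', good_drawing k N.+1 bag p'.
Proof.
move=> N1 kN bs1 [inj gp nc gd].
have bs := bag_systemW (leqnSn N) bs1.
have [u [i [/andP[ku uN] ik bagN]]] : exists u i, [/\ (k <= u < N)%N, (i < k)%N &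
    forall j, (j < k)%N -> bag N j = if j == i then u else bag u j].
  by apply: bs1.2; rewrite kN ltnSn.
have bag_ltN s j : (k <= s < N)%N -> (j < k)%N -> (bag s j < N)%N.
  by move=> /[dup] /andP[_ sN] ks jk; exact: ltn_trans (bag_lt bs ks jk) sN.
have bu j : (j < k)%N -> (bag u j < u)%N by move=> jk; apply: (bag_lt bs); rewrite ?ku.
have inju j j' : (j < k)%N -> (j' < k)%N -> j != j' -> bag u j != bag u j'.
  by move=> jk jk'; apply: contra_neq; apply: (bag_inj bs); rewrite ?ku.
set x := bag u i; have xu := bu i ik : (x < u)%N.
have neu w : (w < u)%N -> w != u by move=> wu; rewrite neq_ltn wu.
have xN := ltn_trans xu uN.
have ux : u != x by rewrite eq_sym neu.
have [v [vA vB vC]] := ex_point_beyond gp uN xN ux (inj u x uN xN ux).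
have vnz a b : (a < N)%N -> (b < N)%N -> a != b -> orient (p a) (p b) v != 0.
  have main (a' b' : nat) : (a' < N)%N -> (b' < N)%N -> a' != b' -> b' != u ->
      orient (p a') (p b') v != 0.
    move=> aN bN ab bnu; have [->|anu] := eqVneq a' u.
      have [->//|bx] := eqVneq b' x.
      by rewrite -sgr_eq0 vB// oppr_eq0 sgr_eq0 gp// eq_sym.
    by rewrite -sgr_eq0 vA// sgr_eq0 gp.
  move=> aN bN ab; have [bu'|bnu] := eqVneq b u; last exact: main.
  rewrite orient_rot orientC oppr_eq0; apply: main => //; by [rewrite eq_sym|rewrite -bu'].
exists (fun n => if n == N then v else p n).
set p' := fun n => _.
have p'N : p' N = v by rewrite /p' eqxx.
have p'E n : (n < N)%N -> p' n = p n by move=> nN; rewrite /p' ltn_eqF.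
have [w [w' [wN wN' ww']]] : exists w w', [/\ (w < N)%N, (w' < N)%N & w != w'].
  by exists 0%N, 1%N; split; lia.
have vnew a : (a < N)%N -> p a != v.
  move=> aN; have [b [bN ab]] : exists b, (b < N)%N /\ a != b.
    by have [->|] := eqVneq a w; [exists w'|exists w].
  by apply: contra_neq (vnz a b aN bN ab) => <-; rewrite /orient; ring.
split.
- have new a : (a < N)%N -> p' a != p' N by move=> aN; rewrite p'N p'E// vnew.
  move=> a b; rewrite !ltnS leq_eqVlt => /orP[/eqP->|aN];
    rewrite leq_eqVlt => /orP[/eqP->|bN]; rewrite ?eqxx// => ab.
  + by rewrite eq_sym new.
  + exact: new.
  + by rewrite !p'E// inj.
- have new a b : (a < N)%N -> (b < N)%N -> a != b -> orient (p' a) (p' b) (p' N) != 0.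
    by move=> aN bN ab; rewrite p'N !p'E// vnz.
  move=> a b c; rewrite !ltnS leq_eqVlt => /orP[/eqP->|aN];
    rewrite leq_eqVlt => /orP[/eqP->|bN]; rewrite leq_eqVlt => /orP[/eqP->|cN];
    rewrite ?eqxx// => ab bc ac.
  + by rewrite orient_rot new.
  + by rewrite orientC oppr_eq0 new.
  + by rewrite new.
  + by rewrite !p'E// gp.
- move=> j s t jk /andP[ks st]; rewrite ltnS leq_eqVlt => /orP[/eqP tN|tN]; last first.
    have sN := ltn_trans st tN.
    have bsN : (bag s j < N)%N by apply: bag_ltN; rewrite ?ks.
    have btN : (bag t j < N)%N by apply: bag_ltN; rewrite // (ltnW (leq_ltn_trans ks st)).
    by rewrite !p'E//; apply: nc => //; rewrite ks.
  move: st; rewrite {t}tN => sN.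
  have bsj : (bag s j < s)%N by apply: (bag_lt bs); rewrite ?ks.
  have bsN := ltn_trans bsj sN.
  rewrite p'N !p'E//; last by rewrite bagN//; case: eqP => // _; exact: ltn_trans (bu _ _) uN.
  (* The edges at [u] and at the new vertex share an end: [u] itself in slot [i], the common bag
     entry in the other slots. *)
  have [->|su] := eqVneq s u.
    by rewrite bagN//; case: eqP => [_|_]; [constructor 2|constructor 1].
  (* In slot [i] the new edge is the short one from [v] to [u], and a line that misses [u] has both
     of its ends on one side. *)
  rewrite bagN//; have [ji|ji] := eqVneq j i.
    have [e|bsu] := eqVneq (bag s j) u; first by constructor 1.
    by constructor 3; left; rewrite vA// neq_ltn bsj orbT.
  have [e|bsb] := eqVneq (bag s j) (bag u j); first by constructor 1.
  have [e|sb] := eqVneq s (bag u j); first by constructor 2.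
  constructor 3; have buN := ltn_trans (bu j jk) uN.
  (* If the old edge ends at [u], then [guarded] puts [s] and [bag u j] on opposite sides of the
     line [x u], hence of the line [u v]. *)
  have [e|bsu] := eqVneq (bag s j) u.
    rewrite e; have sx : s != x by rewrite neq_ltn (ltn_trans xu) ?orbT// -e.
    apply: apart_segments_opposite; last first.
      by rewrite orientC oppr_eq0 vnz// eq_sym neu// bu.
    have := gd s i j; rewrite e ks sN eq_sym ji => /(_ _ _ _ _ _) g.
    rewrite orientC sgrN vB ?neu ?bu// ?opprK; last by apply: inju.
    rewrite [orient _ v _]orientC sgrN vB// !opprK.
    by rewrite orientC sgrN -g// [orient _ (p s) _]orientC sgrN opprK.
  (* Away from [u], the new edge runs along the edge from [u] to [bag u j], and the separation of
     the latter from the edge at [s] carries over. *)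
  have nsu : apart_segments (p s) (p (bag s j)) (p u) (p (bag u j)).
    have [lt_su|lt_us|e] := ltngtP s u.
    - have := nc j s u jk; rewrite ks lt_su => /(_ isT uN)[e|e|//].
        by rewrite e eqxx in bsb.
      by rewrite -e eqxx in sb.
    - have := nc j u s jk; rewrite ku lt_us => /(_ isT sN)[e|e|].
      + by rewrite e eqxx in bsb.
      + by rewrite -e eqxx in bsu.
      + exact: apart_segmentsC.
    - by rewrite e eqxx in su.
  have bsu' : bag s j != s by rewrite neq_ltn bsj.
  case: nsu => h; [left|right]; first by rewrite vA// eq_sym.
  have vb c : (c < N)%N -> c != u -> c != bag u j ->
      Num.sg (orient v (p (bag u j)) (p c)) = Num.sg (orient (p u) (p (bag u j)) (p c)).
    move=> cN cu cb; rewrite (orient_rot v) (orient_rot (p u)).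
    by rewrite vA//; [rewrite eq_sym|rewrite neu ?bu].
  by rewrite !vb.
- move=> s i' j /andP[ks]; rewrite ltnS leq_eqVlt => /orP[/eqP sN|sN] ik' jk ij kb; last first.
    have bsN := bag_ltN _ _ (introT andP (conj ks sN)) jk.
    have b2N l : (l < k)%N -> (bag (bag s j) l < N)%N by apply: bag_ltN; rewrite kb.
    by rewrite !p'E ?b2N//; apply: gd => //; rewrite ks.
  have bN : (bag N j < N)%N by rewrite bagN//; case: eqP => // _; exact: ltn_trans (bu j jk) uN.
  rewrite {s}sN in ks kb *.
  have b2N l : (l < k)%N -> (bag (bag N j) l < N)%N by apply: bag_ltN; rewrite kb.
  rewrite p'N !p'E ?b2N//.
  (* In slot [i] the condition is the choice of [v] beyond [u]; in another slot the relevant line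
     has [v] on the side of [u], and the condition for [u] carries over. *)
  move: kb; rewrite bagN//; have [ji|ji] := eqVneq j i => kb.
    rewrite ji in ij *.
    by rewrite vB//; [exact: ltn_trans (bu i' ik') uN|rewrite neu ?bu|exact: inju].
  have buN := ltn_trans (bu j jk) uN.
  have bblt : (bag (bag u j) i' < bag u j)%N by apply: (bag_lt bs); rewrite ?kb.
  rewrite vA//; [|exact: ltn_trans buN|by rewrite neq_ltn bblt orbT|by rewrite neu ?bu|].
    by apply: gd => //; rewrite ku.
  by rewrite neu// (ltn_trans bblt) ?bu.
Qed.

Lemma good_drawing_exists k N bag : (0 < k)%N -> bag_system k N bag ->
  exists p, good_drawing k N bag p.
Proof.
move=> k0; elim: N => [|N IH] bs; first exact: good_drawing_base.
have [Nk|kN] := leqP N k; first exact: good_drawing_base.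
have [p gp] := IH (bag_systemW (leqnSn N) bs).
by apply: good_drawing_step gp => //; lia.
Qed.

End Drawing.

(** * The complement of a drawn forest *)

Section TreeComplement.
Variable R : realType.
Implicit Types (a b p q x y : plane R) (A D O S U W : set (plane R)) (s t : R).

Lemma orient_segment a b x y t :
  orient a b (x + t *: (y - x)) = (1 - t) * orient a b x + t * orient a b y.
Proof. by rewrite /orient !mxE; ring. Qed.

Lemma orient_lin a b t : orient a b (a + t *: (b - a)) = 0.
Proof. by rewrite /orient !mxE; ring. Qed.

Lemma convex_connected A : (forall x y, A x -> A y -> segment x y `<=` A) -> connected A.
Proof.
move=> cA; have [->|/set0P[x Ax]] := eqVneq A set0; first exact: connected0.
by apply: (@star_connected _ x) => y; exact: cA.
Qed.

Lemma segment_ball p (r : R) x y : ball p r x -> ball p r y -> segment x y `<=` ball p r.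
Proof.
rewrite !ball_planeE => px py _ [t /= + <-]; rewrite in_itv/= ball_planeE => /andP[t0 t1].
have -> : p - (x + t *: (y - x)) = (1 - t) *: (p - x) + t *: (p - y).
  by apply/rowP => i; rewrite !mxE; ring.
apply: le_lt_trans (ler_normD _ _) _; rewrite !normrZ !ger0_norm// ?subr_ge0//.
have [->|tn] := eqVneq t 0; first by rewrite subr0 mul1r mul0r addr0.
have tp : 0 < t by rewrite lt_neqAle eq_sym tn.
have h1 : t * `|p - y| < t * r by rewrite ltr_pM2l.
have h2 : (1 - t) * `|p - x| <= (1 - t) * r by rewrite ler_wpM2l ?subr_ge0// ltW.
by lra.
Qed.

Lemma connected_half_ball a b s p (r : R) :
  connected (ball p r `&` [set q | 0 < s * orient a b q]).
Proof.
apply: convex_connected => x y [px sx] [py sy] q /[dup] /(segment_ball px py) pq [t].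
rewrite /= in_itv/= => /andP[t0 t1] qE; split => //=; rewrite -qE.
rewrite orient_segment mulrDr !(mulrCA s).
have [->|tn] := eqVneq t 0; first by rewrite subr0 mul1r mul0r addr0.
have tp : 0 < t by rewrite lt_neqAle eq_sym tn.
apply: ltr_wpDl; last exact: mulr_gt0.
by apply: mulr_ge0; [rewrite subr_ge0|exact: ltW].
Qed.

Lemma orient_perturb a b s q A : a != b -> s != 0 -> orient a b q = 0 -> nbhs q A ->
  exists2 q', A q' & 0 < s * orient a b q'.
Proof.
move=> ab s0 oq Aq.
pose n : plane R := \row_j (if j == ord0 then - (b - a) ord0 ord_max else (b - a) ord0 ord0).
have on t : orient a b (q + t *: n) =
    orient a b q + t * (((b - a) ord0 ord0) ^+ 2 + ((b - a) ord0 ord_max) ^+ 2).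
  by rewrite /orient /n !mxE /=; ring.
have pos : 0 < ((b - a) ord0 ord0) ^+ 2 + ((b - a) ord0 ord_max) ^+ 2.
  rewrite lt_neqAle addr_ge0 ?sqr_ge0// andbT eq_sym paddr_eq0 ?sqr_ge0// !sqrf_eq0.
  apply: contra ab => /andP[/eqP h0 /eqP h1]; rewrite eq_sym -subr_eq0.
  apply/eqP/rowP => -[[|[|//]] lj]; rewrite [RHS]mxE.
    by rewrite -[RHS]h0; congr (_ _ _); exact: val_inj.
  by rewrite -[RHS]h1; congr (_ _ _); exact: val_inj.
have cont : (fun t : R => q + (t * s) *: n) t @[t --> (0:R)] --> q.
  have -> : nbhs q = nbhs (q + (0 * s) *: n) by rewrite mul0r scale0r addr0.
  apply: cvgD; first exact: cvg_cst.
  by apply: cvgZr_tmp; apply: cvgMr_tmp; exact: cvg_id.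
have /nbhs_ballP[e /= e0 He] := cont _ Aq.
exists (q + (e / 2 * s) *: n).
  by apply: He; rewrite /ball/= sub0r normrN ger0_norm; lra.
rewrite on oq add0r mulrA mulr_gt0// mulrCA mulr_gt0 ?divr_gt0//.
by rewrite -expr2 lt_neqAle sqr_ge0 eq_sym sqrf_eq0 s0.
Qed.

Lemma connected_sub_open (T : topologicalType) (A O1 O2 : set T) : connected A ->
  open O1 -> open O2 -> O1 `&` O2 = set0 -> A `<=` O1 `|` O2 -> A `&` O1 !=set0 ->
  A `<=` O1.
Proof.
move=> cA o1 o2 O12 Asub ne; suff -> : A = A `&` O1 by exact: subIsetr.
apply/esym/cA => //; first by exists O1.
exists (~` O2); first exact: open_closedC.
apply/seteqP; split => x [Ax Ox]; split => //.
  by move=> O2x; have : (O1 `&` O2) x by []; rewrite O12.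
by case: (Asub x Ax).
Qed.

Lemma connected_openP (T : topologicalType) (W : set T) : open W ->
  (forall O : bool -> set T, (forall i, open (O i)) -> O false `&` O true = set0 ->
     O false `|` O true = W -> (forall i, O i !=set0) -> False) -> connected W.
Proof.
move=> oW H B [x Bx] [C1 oC1 BC1] [C2 cC2 BC2].
apply: contrapT => BW; pose O i := if i then B else W `\` B.
have BsW : B `<=` W by rewrite BC1; exact: subIsetl.
have WB : W `\` B = W `&` ~` C2.
  apply/seteqP; split => y [Wy nBy]; split => //; first by move=> Cy; apply: nBy; rewrite BC2.
  by rewrite BC2 => -[].
apply: (H O).
- case; rewrite /O; first by rewrite BC1; exact: openI.
  by rewrite WB; apply: openI => //; exact: closed_openC.
- by rewrite /O setDE -setIA setICl setI0.
- by rewrite /O setUC setDUK.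
- case; first by exists x.
  by apply/set0P; apply: contra_notN BW => /eqP; rewrite setD_eq0 => WB'; apply/seteqP.
Qed.

(* Removing from U a slit that starts inside U: the two sides of the slit are each
   contained in one piece of a separation of U minus the slit, and they are in
   the same piece by going around the end a. *)
Lemma connected_slit U a b (I : set R) : a != b -> open U -> connected U ->
  is_interval I -> I 0 -> (forall t, I t -> 0 <= t) ->
  let S := [set a + t *: (b - a) | t in I] in
  S `<=` U -> open (U `\` S) -> connected (U `\` S).
Proof.
move=> ab oU cU itvI I0 Ige0 S SU oW; apply: connected_openP => // O oO O12 OW neO.
have OUn i : O i `<=` U `\` S by rewrite -OW; case: i => x Ox; [right|left].
have Odis i q : O i q -> O (~~ i) q -> False.
  move=> h1 h2; suff : (O false `&` O true) q by rewrite O12.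
  by case: i h1 h2.
pose pt t := a + t *: (b - a).
have Lpt t : orient a b (pt t) = 0 := orient_lin a b t.
have cpt : continuous pt by exact: segment_continuous.
pose side s i t := exists2 r : R, 0 < r &
  ball (pt t) r `&` [set q | 0 < s * orient a b q] `<=` O i.
have sideP s t : s != 0 -> I t -> side s false t \/ side s true t.
  move=> s0 It; have /nbhs_ballP[r /= r0 rU] : nbhs (pt t) U.
    by apply: open_nbhs_nbhs; split => //; apply: SU; exists t.
  have [q rq sq] := orient_perturb ab s0 (Lpt t) (nbhsx_ballx (pt t) r r0).
  set H := ball (pt t) r `&` [set q | 0 < s * orient a b q].
  have HW : H `<=` O false `|` O true.
    rewrite OW => z [zr sz]; split; first exact: rU.
    by move=> [t' _ zt]; move: sz; rewrite /= -zt Lpt mulr0 ltxx.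
  have [Oq|Oq] := HW q (conj rq sq); [left|right]; exists r => //.
    apply: (connected_sub_open _ (oO false) (oO true)) => //; last by exists q.
    exact: connected_half_ball.
  apply: (connected_sub_open _ (oO true) (oO false)) => //; [exact: connected_half_ball| | |].
  - by rewrite setIC.
  - by rewrite setUC.
  - by exists q.
have side_open s i : open (side s i).
  move=> t [r r0 rO]; have r2 : 0 < r / 2 by rewrite divr_gt0.
  have : nbhs t (pt @^-1` ball (pt t) (r / 2)) by apply: cpt; exact: nbhsx_ballx.
  apply: filterS => t' /= tt'.
  exists (r / 2) => //.
  move=> q [t'q sq]; apply: rO; split => //.
  move: tt' t'q; rewrite !ball_planeE => h1 h2; apply: le_lt_trans (ler_distD (pt t') _ _) _; lra.
have side_excl s t : s != 0 -> side s false t -> side s true t -> False.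
  move=> s0 [r r0 rO] [r' r'0 rO'].
  have [q [rq rq'] sq] := orient_perturb ab s0 (Lpt t)
    (filterI (nbhsx_ballx (pt t) r r0) (nbhsx_ballx (pt t) r' r'0)).
  by apply: (Odis false q); [exact: rO|exact: rO'].
(* The piece containing the side [s] near [pt t] is locally constant in [t], hence constant on the
   interval. *)
have side_const s i t : s != 0 -> side s i 0 -> I t -> side s i t.
  move=> s0 si It; have cI : connected I by apply/connected_intervalP.
  have sdis : side s false `&` side s true = set0.
    by apply/seteqP; split => // t' [h1 h2]; case: (side_excl s t').
  case: i si => si.
    apply: (connected_sub_open cI (side_open s true) (side_open s false)) It.
    + by rewrite setIC.
    + by rewrite setUC => t'; exact: sideP.
    + by exists 0.
  apply: (connected_sub_open cI (side_open s false) (side_open s true)) It => //.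
  + by move=> t'; exact: sideP.
  + by exists 0.
have meet s i j q : s != 0 -> orient a b q = 0 -> O j q ->
    (exists2 N : set (plane R), nbhs q N & N `&` [set q | 0 < s * orient a b q] `<=` O i) -> i = j.
  move=> s0 oq Oj [N Nq NO].
  have Ojq : nbhs q (O j) by apply: open_nbhs_nbhs; split.
  have [q' [Nq' Oj'] sq] := orient_perturb ab s0 oq (filterI Nq Ojq).
  have Oi' : O i q' by exact: NO.
  by apply/eqP; apply: contraT => /negP ij; case: (Odis i q' Oi'); case: (i) (j) ij Oj' => -[].
have [i sides] : exists i, forall s t, s != 0 -> I t -> side s i t.
  have s1 : exists i, side 1 i 0.
    by case: (sideP 1 0 (oner_neq0 R) I0) => h; [exists false|exists true].
  have [i si] := s1; exists i => s t s0 It.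
  apply: side_const => //.
  have [j sj] : exists j, side s j 0.
    by case: (sideP s 0 s0 I0) => h; [exists false|exists true].
  suff -> : i = j by [].
  have [r r0 rO] := si; have [r' r'0 rO'] := sj.
  have aU : nbhs (pt 0) U by apply: open_nbhs_nbhs; split => //; apply: SU; exists 0.
  have NU : nbhs (0:R) (pt @^-1` U) by apply: cpt; exact: aU.
  have Nr : nbhs (0:R) (pt @^-1` ball (pt 0) r) by apply: cpt; exact: nbhsx_ballx.
  have Nr' : nbhs (0:R) (pt @^-1` ball (pt 0) r') by apply: cpt; exact: nbhsx_ballx.
  (* The point [pt d] lies on the line just before the end [a], off the slit. The piece containing
     it meets the half-balls on both sides, so both sides lie in that piece. *)
  have [d [d0 dN]] : exists d : R, d < 0 /\ U (pt d) /\ ball (pt 0) r (pt d) /\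
      ball (pt 0) r' (pt d).
    have N3 : nbhs (0:R) (pt @^-1` U `&` (pt @^-1` ball (pt 0) r `&` pt @^-1` ball (pt 0) r')).
      by apply: filterI => //; apply: filterI.
    have /nbhs_ballP[e /= e0 He] := N3.
    exists (- (e / 2)); split; first by rewrite oppr_lt0 divr_gt0.
    by have [|? []] := He (- (e / 2)); first by rewrite /ball/= sub0r opprK ger0_norm; lra.
  pose q := pt d; case: dN => Uq [rq r'q].
  have Wq : (U `\` S) q.
    split => // -[t' It' /addrI/eqP]; rewrite -subr_eq0 -scalerBl scaler_eq0 subr_eq0 subr_eq0.
    rewrite [b == a]eq_sym (negbTE ab) orbF => /eqP e.
    by have := Ige0 t' It'; rewrite e leNgt d0.
  have [l Ol] : exists l, O l q by move: Wq; rewrite -OW => -[]; [exists false|exists true].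
  transitivity l.
    apply: (meet 1 i l q) => //; first exact: Lpt.
    by exists (ball (pt 0) r) => //; apply: open_nbhs_nbhs; split => //; exact: ball_open.
  apply/esym; apply: (meet s j l q) => //; first exact: Lpt.
  by exists (ball (pt 0) r') => //; apply: open_nbhs_nbhs; split => //; exact: ball_open.
(* With both sides in [O i], putting the slit back keeps this piece open, and the separation extends
   to [U]. *)
have oOS : open (O i `|` S).
  move=> q [Oq|[t It qt]].
    have : nbhs q (O i) by apply: open_nbhs_nbhs; split.
    by apply: filterS => z Oz; left.
  have m1 : (-1 : R) != 0 by rewrite oppr_eq0 oner_eq0.
  have [r r0 rO] := sides 1 t (oner_neq0 R) It; have [r' r'0 rO'] := sides (-1) t m1 It.
  have qU : nbhs q U by apply: open_nbhs_nbhs; split => //; apply: SU; exists t.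
  have NB : nbhs q (U `&` (ball q r `&` ball q r')).
    by do 2 (apply: filterI => //); exact: nbhsx_ballx.
  apply: filterS NB => z [Uz [rz r'z]].
  rewrite -qt in rz r'z.
  have [oz|oz|oz] := ltgtP 0 (orient a b z).
  - by left; apply: rO; split => //=; rewrite mul1r.
  - by left; apply: rO'; split => //=; rewrite mulN1r oppr_gt0.
  - have [Sz|nSz] := pselect (S z); [by right|left].
    have [l Ol] : exists l, O l z.
      have : (U `\` S) z by []. by rewrite -OW => -[]; [exists false|exists true].
    suff -> : i = l by [].
    apply: (meet 1 i l z (oner_neq0 R)) => //.
    by exists (ball (pt t) r) => //; apply: open_nbhs_nbhs; split => //; exact: ball_open.
have [z Oz] := neO (~~ i).
suff : (O i `|` S) z.
  by case=> [Oz'|Sz]; [exact: Odis Oz' Oz|have [_] := OUn _ _ Oz].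
have Uz : U z by have [] := OUn _ _ Oz.
apply: (connected_sub_open cU oOS (oO (~~ i))) Uz.
- apply/seteqP; split => // y [[Oy|Sy] Oy']; first exact: Odis Oy Oy'.
  by have [_ /(_ Sy)] := OUn _ _ Oy'.
- move=> y Uy; have [Sy|nSy] := pselect (S y); first by left; right.
  have : (U `\` S) y by [].
  by rewrite -OW; case: (i) => -[]; rewrite /setU /=; tauto.
- exists a; split; last by right; exists 0 => //; rewrite scale0r addr0.
  by apply: SU; exists 0 => //; rewrite scale0r addr0.
Qed.

Lemma dense_setC_segment a b : a != b -> dense (~` segment a b).
Proof.
move=> ab O [q Oq] oO; have Nq : nbhs q O by apply: open_nbhs_nbhs; split.
have [qline|qline] := eqVneq (orient a b q) 0; last first.
  by exists q; split => // -[t _ qt]; rewrite -qt orient_lin eqxx in qline.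
have [z Oz h] := orient_perturb ab (oner_neq0 R) qline Nq.
rewrite mul1r in h; exists z; split => // -[t _ zt].
by rewrite -zt orient_lin ltxx in h.
Qed.

Lemma ex_neq_plane a : exists b, a != b.
Proof.
exists (a + const_mx 1); rewrite -subr_eq0 opprD addrA subrr sub0r oppr_eq0.
by apply/eqP => /rowP/(_ ord0); rewrite !mxE; exact/eqP/oner_neq0.
Qed.

(** The construction order is recorded so that each step is one slit: a new point off the old set,
    or a pendant segment whose end [b] is old. *)
Inductive drawn_forest : set (plane R) -> Prop :=
| drawn_forest0 : drawn_forest set0
| drawn_forest_point D a : drawn_forest D -> ~ D a -> drawn_forest (D `|` [set a])
| drawn_forest_edge D a b : drawn_forest D -> a != b -> D b ->
    (forall z, D z -> segment a b z -> z = b) -> drawn_forest (D `|` segment a b).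

Lemma drawn_forest_compl D : drawn_forest D ->
  [/\ compact D, dense (~` D) & connected (~` D)].
Proof.
have ccl A : compact A -> closed A by apply: compact_closed; exact: norm_hausdorff.
elim=> {D} [|D a _ [cD dD conD] nDa|D a b _ [cD dD conD] ab Db Dab].
- split; first exact: compact0.
    by rewrite setC0 => O [q Oq] _; exists q.
  by apply: convex_connected => x y _ _ z _; rewrite setC0.
- have cS : compact [set a] by exact: compact_set1.
  have [b ab] := ex_neq_plane a.
  have oD : open (~` D) by apply: closed_openC; exact: ccl.
  have oS : open (~` [set a]) by apply: closed_openC; exact: ccl.
  split; first exact: compactU.
    rewrite setCU; apply: denseI => //.
    move=> O neO oO; have [z [Oz nz]] := dense_setC_segment ab neO oO.
    by exists z; split => // za; apply: nz; rewrite za; exact: segmentl.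
  (* A point is a degenerate slit; the direction towards [b] is arbitrary. *)
  have SE : [set a + t *: (b - a) | t in [set 0]] = [set a].
    by rewrite image_set1 scale0r addr0.
  rewrite setCU -setDE -SE; apply: connected_slit => //.
  + by move=> x y -> -> z /andP[z1 z2]; apply/eqP; rewrite eq_le z1 z2.
  + by move=> t ->.
  + by rewrite SE => _ ->.
  + by rewrite SE setDE; exact: openI.
- have cS : compact (segment a b) by exact: compact_segment.
  have oD : open (~` D) by apply: closed_openC; exact: ccl.
  have oS : open (~` segment a b) by apply: closed_openC; exact: ccl.
  split; first exact: compactU.
    by rewrite setCU; apply: denseI => //; exact: dense_setC_segment.
  (* The slit is half-open because its end [b] already belongs to [D]. *)
  pose S := [set a + t *: (b - a) | t in [set` `[0, 1[ ]].
  have SS : S `<=` segment a b.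
    move=> _ [t /= + <-]; rewrite in_itv/= => /andP[t0 t1]; exists t => //=.
    by rewrite in_itv/= t0 ltW.
  have WE : ~` D `\` S = ~` (D `|` segment a b).
    rewrite setCU setDE; apply/seteqP; split => z [nD nS]; split => //; last by move=> /SS.
    move=> [t /= + zt]; rewrite in_itv/= => /andP[t0]; rewrite le_eqVlt => /orP[/eqP t1|t1].
      by apply: nD; rewrite -zt t1 scale1r addrC subrK.
    by apply: nS; exists t => //=; rewrite in_itv/= t0.
  rewrite -WE; apply: connected_slit => //.
  + exact: interval_is_interval.
  + by rewrite /= in_itv/= lexx ltr01.
  + by move=> t; rewrite /= in_itv/= => /andP[].
  + move=> _ [t /= + <-] Dz; have := Dab _ Dz; rewrite in_itv/= => h /andP[t0 t1].
    have : a + t *: (b - a) = b by apply: h; exists t => //=; rewrite in_itv/= t0 ltW.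
    move=> /eqP; rewrite -subr_eq0 addrAC -opprB addrC -[X in _ - X]scale1r -scalerBl.
    rewrite scaler_eq0 !subr_eq0 [b == a]eq_sym (negbTE ab) orbF => /eqP te.
    by rewrite te ltxx in t1.
  + by rewrite WE; rewrite setCU; exact: openI.
Qed.

Lemma unbounded_component_compl D : compact D -> dense (~` D) -> connected (~` D) ->
  unbounded_component D (~` D).
Proof.
move=> cD dD conD; split.
  have [x [_ Dx]] := dD setT (ex_intro _ 0 I) openT.
  by exists x => //; rewrite connected_component_id.
move=> bC; have bD := compact_bounded cD.
have [M [_ HM]] : bounded_set [set: plane R].
  move: bC bD => [M [Mr HM]] [M' [Mr' HM']]; exists (Num.max M M'); split.
    exact: num_real.
  move=> m; rewrite gt_max => /andP[h h'] x _.
  by have [Dx|nDx] := pselect (D x); [exact: HM'|exact: HM].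
have := HM (`|M| + 1); rewrite ltr_pwDr ?ler_norm// => /(_ isT (const_mx (`|M| + 2)) I) /=.
apply/negP; rewrite -ltNge; apply: (@lt_le_trans _ _ (`|M| + 2)); first by lra.
by rewrite norm_ge_coord !mxE ler_norm.
Qed.

(** The complement is a single face, and its density puts every vertex on its boundary. *)
Lemma outer_drawn_forest (T : finType) (V : {set T}) F pos curve :
  drawn_forest (drawn_points V F pos curve) -> outer (R := R) V F pos curve.
Proof.
move=> /drawn_forest_compl[cD dD conD]; exists (~` drawn_points V F pos curve).
  exact: unbounded_component_compl.
move=> v vV; split.
  move=> B /nbhs_interior/nbhs_singleton vB.
  have [z [Bz nz]] := dD _ (ex_intro _ _ vB) (@open_interior _ B).
  by exists z; split => //; exact: interior_subset Bz.
by rewrite setCK; apply: subset_closure; left; exists v.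
Qed.

Lemma segment_avoids a b c : orient a b c != 0 -> ~ segment a b c.
Proof. by move=> o0 [t _ ct]; rewrite -ct orient_lin eqxx in o0. Qed.

Lemma segment_share a b c z : orient a b c != 0 -> segment a b z -> segment a c z -> z = a.
Proof.
move=> o0 [t _ <-] [t' _ zt]; move: (orient_lin a b t); rewrite -zt orient_segment.
rewrite (_ : orient a b a = 0) ?mulr0 ?add0r; last by rewrite /orient; ring.
by move/eqP; rewrite mulf_eq0 (negbTE o0) orbF => /eqP->; rewrite scale0r addr0.
Qed.

Lemma apart_segments_disjoint a b c d z : apart_segments a b c d ->
  orient a b c != 0 -> orient c d a != 0 -> segment a b z -> segment c d z -> False.
Proof.
have main u v x y : Num.sg (orient u v x) = Num.sg (orient u v y) ->
    orient u v x != 0 -> segment u v z -> segment x y z -> False.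
  move=> sxy x0 [t _ <-] [t' + zt]; rewrite /= in_itv/= => /andP[t0 t1].
  move: (orient_lin u v t); rewrite -zt orient_segment => /eqP; apply/negP.
  move: sxy x0; rewrite neq_lt => + /orP[]x0; [rewrite (ltr0_sg x0)|rewrite (gtr0_sg x0)];
    move=> /esym/eqP; rewrite sgr_cp0 => y0.
    rewrite lt_eqF// -oppr_gt0; have [->|tn] := eqVneq t' 0.
      by rewrite subr0 mul1r mul0r addr0 oppr_gt0.
    have tp : 0 < t' by rewrite lt_neqAle eq_sym tn.
    have h1 : t' * orient u v y < 0 by rewrite pmulr_rlt0.
    have h2 : (1 - t') * orient u v x <= 0 by rewrite mulr_ge0_le0 ?subr_ge0// ltW.
    by lra.
  rewrite gt_eqF//; have [->|tn] := eqVneq t' 0.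
    by rewrite subr0 mul1r mul0r addr0.
  have tp : 0 < t' by rewrite lt_neqAle eq_sym tn.
  have h1 : 0 < t' * orient u v y by rewrite mulr_gt0.
  have h2 : 0 <= (1 - t') * orient u v x.
    by apply: mulr_ge0; [rewrite subr_ge0|exact: ltW].
  by lra.
by case=> s oab ocd za zc; [exact: main s oab za zc|exact: main s ocd zc za].
Qed.
End TreeComplement.

Lemma eq_set2 (T : finType) (x y x' y' : T) : [set x; y]%SET = [set x'; y']%SET ->
  (x = x' /\ y = y') \/ (x = y' /\ y = x').
Proof.
move=> /finset.setP e; have := e x; have := e y; have := e x'; have := e y'.
rewrite !inE !eqxx ?orbT /= => /orP[]/eqP e1 /orP[]/eqP e2;
  move=> /esym/orP[]/eqP e3 /esym/orP[]/eqP e4; subst; auto.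
Qed.

(** * Forests in which every vertex has at most one earlier neighbour *)

Section Oriented.
Variables (R : realType) (T : finType).
Variables (F : {set {set T}}) (idx : T -> nat).
Hypothesis idx_inj : injective idx.
Hypothesis edge_oriented : forall e, e \in F ->
  exists x y, e = [set x; y]%SET /\ (idx x < idx y)%N.
Hypothesis parent_unique : forall x x' y, [set x; y]%SET \in F -> [set x'; y]%SET \in F ->
  (idx x < idx y)%N -> (idx x' < idx y)%N -> x = x'.

(** The last vertex on a cycle of length at least 3 would have two distinct earlier neighbours. *)
Lemma oriented_forest : is_forest (graph_of_edges F).
Proof.
move=> c uc cc; rewrite leqNgt; apply/negP => size_c.
have [x0 x0c] : exists x, x \in c by case: c size_c {uc cc} => // x c _; exists x; rewrite mem_head.
have [m mc mmax] : exists2 m, m \in c & forall x, x \in c -> (idx x <= idx m)%N.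
  by have [m mc mmax] := @arg_maxnP _ x0 (mem c) idx x0c; exists m.
have [i p cE] := rot_to mc.
have : cycle (graph_of_edges F) (m :: p) by rewrite -cE rot_cycle.
have : uniq (m :: p) by rewrite -cE rot_uniq.
have : (2 < size (m :: p))%N by rewrite -cE size_rot.
have pc x : x \in p -> x \in c.
  by move=> xp; rewrite -(mem_rot i) cE inE xp orbT.
case: p {cE} pc => [//|y [//|z p]] pc _ /=.
rewrite !inE !negb_or => /and3P[/and3P[my mz mp] /andP[yz yp] _].
move=> /andP[/andP[_ myF]]; rewrite rcons_path => /andP[/andP[_ _]] /andP[_ lF].
set l := last z p in lF.
have lzp : l \in z :: p by exact: mem_last.
have lt x : x \in y :: z :: p -> x != m -> (idx x < idx m)%N.
  by move=> /pc xc xm; rewrite ltn_neqAle mmax// andbT; apply: contra_neq xm; exact: idx_inj.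
have ml : l != m.
  by move: lzp; rewrite inE => /orP[/eqP->|lp]; [rewrite eq_sym|apply: contraNneq mp => <-].
have /esym yl : y = l.
  apply: (@parent_unique _ _ m) => //; first by rewrite finset.setUC.
    by case/andP: lF.
    by apply: lt; [rewrite mem_head|rewrite eq_sym].
  by apply: lt => //; rewrite inE lzp orbT.
by move: lzp; rewrite yl inE (negbTE yz) (negbTE yp).
Qed.

Variables (V : {set T}) (pos : T -> plane R) (curve : {set T} -> set (plane R)).
Hypothesis pos_inj : injective pos.
Hypothesis curve_segment : forall x y, [set x; y]%SET \in F ->
  curve [set x; y]%SET = segment (pos x) (pos y).
Hypothesis curve_vertex : forall x y z, [set x; y]%SET \in F ->
  curve [set x; y]%SET (pos z) -> z = x \/ z = y.
Hypothesis F_noncrossing : noncrossing F pos curve.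
Hypothesis coverFV : finset.cover F \subset V.

Let Vn n := [set v in V | (idx v < n)%N]%SET.
Let Fn n := [set e in F | [forall v in e, (idx v < n)%N]]%SET.
Let Dn n := drawn_points (Vn n) (Fn n) pos curve.

Let FnP n x y : [set x; y]%SET \in F -> (idx x < n)%N -> (idx y < n)%N ->
  [set x; y]%SET \in Fn n.
Proof.
move=> xyF xn yn; rewrite inE xyF; apply/forallP => v; rewrite !inE.
by apply/implyP => /orP[] /eqP->.
Qed.

Let Fn_lt n e v : e \in Fn n -> v \in e -> (idx v < n)%N.
Proof. by rewrite inE => /andP[_ /forallP/(_ v)/implyP]. Qed.

Let F_in_V e v : e \in F -> v \in e -> v \in V.
Proof.
by move=> eF ve; apply: (fintype.subsetP coverFV); apply/bigcupP; exists e.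
Qed.

(** Vertices enter in the order of [idx]; each is an isolated point on entry or a leaf hanging on
    its only earlier neighbour. *)
Lemma drawn_forest_oriented : drawn_forest (drawn_points V F pos curve).
Proof.
suff H n : drawn_forest (Dn n).
  have := H (\max_(v : T) idx v).+1; rewrite /Dn.
  have lt v : (idx v < (\max_(v : T) idx v).+1)%N by rewrite ltnS leq_bigmax.
  have -> : Vn (\max_(v : T) idx v).+1 = V by apply/finset.setP => v; rewrite inE lt andbT.
  have -> // : Fn (\max_(v : T) idx v).+1 = F.
  apply/finset.setP => e; rewrite inE; case: (e \in F) => //=.
  by apply/forallP => v; rewrite lt implybT.
elim: n => [|n IH].
  have -> : Dn 0 = set0.
    apply/seteqP; split => // z [[v]|[e eF _]]; first by rewrite inE ltn0 andbF.
    have [|x [y [exy _]]] := edge_oriented (e := e); first by move: eF; rewrite inE => /andP[].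
    by have := Fn_lt (v := x) eF; rewrite exy set21 => /(_ isT).
  exact: drawn_forest0.
have mono : Dn n `<=` Dn n.+1.
  move=> z [[v]|[e]]; rewrite inE => /andP[h1 h2] h3.
    by left; exists v => //; rewrite inE h1 ltnW.
  right; exists e => //; rewrite inE h1; apply/forallP => v; apply/implyP => ve.
  by move/forallP: h2 => /(_ v)/implyP/(_ ve)/ltnW.
have [/existsP[v /andP[vV /eqP vn]]|noV] := boolP [exists v, (v \in V) && (idx v == n)]; last first.
  have lt v : v \in V -> (idx v < n.+1)%N -> (idx v < n)%N.
    move=> vV; rewrite ltnS leq_eqVlt => /orP[vn|//].
    by move/existsP: noV => []; exists v; rewrite vV.
  suff -> : Dn n.+1 = Dn n by [].
  apply/seteqP; split => // z [[v]|[e]].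
    by rewrite inE => /andP[vV vn] vz; left; exists v => //; rewrite inE vV lt.
  move=> eFn ez; right; exists e => //; have eF : e \in F by move: eFn; rewrite inE => /andP[].
  rewrite inE eF; apply/forallP => v; apply/implyP => ve.
  by apply: lt; [exact: F_in_V ve|exact: Fn_lt ve].
have new z : Dn n.+1 z -> [\/ Dn n z, z = pos v |
    exists2 u, [set u; v]%SET \in F /\ (idx u < n)%N & segment (pos v) (pos u) z].
  move=> [[w]|[e eFn]].
    rewrite inE ltnS leq_eqVlt => /andP[wV /orP[/eqP wn|wn]] <-.
      by constructor 2; congr pos; apply: idx_inj; rewrite wn.
    by constructor 1; left; exists w => //; rewrite inE wV.
  have eF : e \in F by move: eFn; rewrite inE => /andP[].
  have [x [y [exy xy]]] := edge_oriented eF; rewrite exy in eF eFn *.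
  have := Fn_lt (v := y) eFn; rewrite set22 ltnS leq_eqVlt => /(_ isT)/orP[/eqP yn|yn] cz.
    have yv : y = v by apply: idx_inj; rewrite yn.
    constructor 3; exists x; first by rewrite -yv -yn.
    by rewrite segmentC -yv -curve_segment.
  by constructor 1; right; exists [set x; y]%SET => //; apply: FnP => //; exact: ltn_trans yn.
have Dv : Dn n.+1 (pos v) by left; exists v => //; rewrite inE vV vn ltnSn.
have Dn_edge z : Dn n z -> (exists2 w, (idx w < n)%N & pos w = z) \/
    exists x y, [/\ [set x; y]%SET \in F, (idx x < n)%N, (idx y < n)%N & curve [set x; y]%SET z].
  move=> [[w]|[e eFn ez]]; first by rewrite inE => /andP[_ wn] wz; left; exists w.
  have eF : e \in F by move: eFn; rewrite inE => /andP[].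
  have [x [y [exy xy]]] := edge_oriented eF; right; exists x, y.
  by rewrite exy in eF eFn ez; split => //; apply: Fn_lt eFn _; rewrite !inE eqxx ?orbT.
have [/existsP[u /andP[uvF un]]|noU] :=
    boolP [exists u, ([set u; v]%SET \in F) && (idx u < n)%N].
  have -> : Dn n.+1 = Dn n `|` segment (pos v) (pos u).
    apply/seteqP; split => [z /new[|->|[u' [u'F u'n]]]|z [/mono//|uvz]]; first by left.
    - by right; exact: segmentl.
    - suff -> : u' = u by right.
      by apply: parent_unique u'F uvF _ _; rewrite vn.
    - right; exists [set u; v]%SET; last by rewrite curve_segment// segmentC.
      by apply: FnP => //; [exact: ltnW|rewrite vn].
  apply: drawn_forest_edge => //.
  - by apply/eqP => /pos_inj vu; rewrite -vu vn ltnn in un.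
  - by left; exists u => //; rewrite inE un (F_in_V uvF)// set21.
  - move=> z Dz uvz; have cz : curve [set u; v]%SET z by rewrite curve_segment// segmentC.
    have [[w wn wz]|[x [y [xyF xn yn xyz]]]] := Dn_edge z Dz.
      rewrite -wz in cz *; have [->//|wv] := curve_vertex uvF cz.
      by rewrite wv vn ltnn in wn.
    have ne : [set u; v]%SET != [set x; y]%SET.
      apply/eqP => /finset.setP/(_ v); rewrite !inE eqxx orbT => /esym/orP[]/eqP ev.
        by rewrite -ev vn ltnn in xn.
      by rewrite -ev vn ltnn in yn.
    apply: contrapT => zu; apply: (F_noncrossing uvF xyF ne); exists z; split => //.
    move=> [w []]; rewrite !inE => /orP[/eqP->|/eqP->] => [_ /esym//|/orP[]/eqP ev _].
      by rewrite -ev vn ltnn in xn.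
    by rewrite -ev vn ltnn in yn.
have -> : Dn n.+1 = Dn n `|` [set pos v].
  apply/seteqP; split => [z /new[|->|[u [uvF un]]]|z [/mono//|->//]]; [by left|by right|].
  by move/existsP: noU => []; exists u; rewrite uvF.
apply: drawn_forest_point => // /Dn_edge[[w wn /pos_inj wv]|[x [y [xyF xn yn]]]].
  by rewrite wv vn ltnn in wn.
by move=> /(curve_vertex xyF)[] ev; rewrite -ev vn ltnn in xn yn.
Qed.
End Oriented.

(** * Coloured straight-line drawings of graphs of bounded treewidth *)

Lemma segment_arc (R : realType) (a b : plane R) : a != b -> is_arc a b (segment a b).
Proof.
move=> ab; exists (fun t => a + t *: (b - a)); split => //.
- exact/continuous_subspaceT/segment_continuous.
- move=> s t _ _ /addrI/eqP; rewrite -subr_eq0 -scalerBl scaler_eq0 !subr_eq0.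
  by rewrite [b == a]eq_sym (negbTE ab) orbF => /eqP.
- by rewrite scale0r addr0.
- by rewrite scale1r addrC subrK.
Qed.

(** Edges are unordered sets, so both orders of the ends are allowed; they give the same segment by
    [segmentC]. *)
Definition straight_curve (R : realType) (T : finType) (pos : T -> plane R)
    (e : {set T}) : set (plane R) :=
  [set z | exists x y, e = [set x; y]%SET /\ segment (pos x) (pos y) z].

Lemma straight_curveE (R : realType) (T : finType) (pos : T -> plane R) x y :
  straight_curve pos [set x; y]%SET = segment (pos x) (pos y).
Proof.
apply/seteqP; split => z; last by exists x, y.
by move=> [x' [y' [/eq_set2[] [-> ->]]]]; rewrite // segmentC.
Qed.

Lemma edgesP (T : finType) (G : sgraph T) e :
  reflect (exists x y, G x y /\ e = [set x; y]%SET) (e \in edges G).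
Proof.
apply: (iffP imsetP) => [[[x y] Gxy ->]|[x [y [Gxy ->]]]].
  by exists x, y; split => //; rewrite inE in Gxy.
by exists (x, y) => //; rewrite inE.
Qed.

Lemma mem_edges (T : finType) (G : sgraph T) x y : ([set x; y]%SET \in edges G) = G x y.
Proof.
apply/edgesP/idP => [[x' [y' [Gxy /eq_set2[] [-> ->]]]]|Gxy]; rewrite // 1?adj_sym//.
by exists x, y.
Qed.

(** Positions come from a [w]-tree [H] containing [G], colours from its slots. The set [V] is left
    free: outerplanarity asks for all vertices, geometric outerthickness for the endpoints of
    [F]. *)
Lemma treewidth_drawing (R : realType) (k : nat) (T : finType) (G : sgraph T) :
  (0 < k)%N -> treewidth_le k G ->
  exists (pos : T -> plane R) (col : {set T} -> 'I_k),
    is_geometric_drawing G pos (straight_curve pos) /\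
    forall (F : {set {set T}}) j, {subset F <= edges G} -> (forall e, e \in F -> col e = j) ->
      [/\ is_forest (graph_of_edges F), noncrossing F pos (straight_curve pos) &
        forall V : {set T}, finset.cover F \subset V -> outer V F pos (straight_curve pos)].
Proof.
move=> k0 [w [[[H [Hw GH]] _] wk]].
have [s [bag [us sT [bs lay]]]] := ktree_layout k0 wk Hw.
have {}sT x : x \in s by rewrite sT inE.
have [p [pinj gp nc _]] := good_drawing_exists R k0 bs.
pose idx x := (k + index x s)%N.
have idx_inj : injective idx.
  by move=> x y /addnI e; rewrite -(nth_index x (sT x)) e nth_index.
have idxN x : (idx x < k + size s)%N by rewrite ltn_add2l index_mem.
have kidx x : (k <= idx x)%N by rewrite leq_addr.
pose pos x := p (idx x).
have idx_neq x y : x != y -> idx x != idx y by apply: contra_neq; exact: idx_inj.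
have pos_neq x y : x != y -> pos x != pos y by move=> /idx_neq xy; exact: pinj.
have pos_inj : injective pos.
  by move=> x y xy; apply/eqP; apply: contraT => /pos_neq; rewrite xy eqxx.
have gpos x y z : x != y -> y != z -> x != z -> orient (pos x) (pos y) (pos z) != 0.
  by move=> /idx_neq xy /idx_neq yz /idx_neq xz; apply: gp.
pose child (e : {set T}) (j : 'I_k) x y := (e == [set x; y]%SET) && (bag (idx y) j == idx x).
have ex_child x y : G x y -> exists j x' y', child [set x; y]%SET j x' y'.
  move=> /GH Hxy; have [xy|yx|e] := ltngtP (index x s) (index y s).
  - have [j jk e] := lay x y (sT x) (sT y) Hxy xy.
    by exists (Ordinal jk), x, y; rewrite /child eqxx /= e.
  - rewrite adj_sym in Hxy; have [j jk e] := lay y x (sT y) (sT x) Hxy yx.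
    by exists (Ordinal jk), y, x; rewrite /child finset.setUC eqxx /= e.
  - by move: Hxy; rewrite -(nth_index x (sT x)) e nth_index// adj_irrefl.
(* The slot of the earlier end in the bag of the later one; the default concerns non-edges only. *)
pose col e := odflt (Ordinal k0) [pick j | [exists x, exists y, child e j x y]].
have childP e : e \in edges G -> exists x y, child e (col e) x y.
  move=> /edgesP[x [y [Gxy ->]]]; rewrite /col; case: pickP => [j /existsP[x' /existsP[y' c]]|none].
    by exists x', y'.
  have [j [x' [y' c]]] := ex_child x y Gxy.
  by have /negP[] := negbT (none j); apply/existsP; exists x'; apply/existsP; exists y'.
have child_lt e j x y : child e j x y -> (idx x < idx y)%N.
  by move=> /andP[_ /eqP<-]; apply: (bag_lt bs); rewrite ?kidx ?idxN.
have Gneq x y : G x y -> x != y by apply: contraTneq => ->; rewrite adj_irrefl.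
have avoid x y z : G x y -> straight_curve pos [set x; y]%SET (pos z) -> z = x \/ z = y.
  move=> /Gneq xy; rewrite straight_curveE => sz.
  have [->|zx] := eqVneq z x; [by left|right].
  have [//|zy] := eqVneq z y; case: (@segment_avoids R (pos x) (pos y) (pos z)) => //.
  by apply: gpos; rewrite // eq_sym.
have share x y y' z : x != y -> x != y' -> y != y' -> segment (pos x) (pos y) z ->
    segment (pos x) (pos y') z -> pos x = z.
  by move=> xy xy' yy' h h'; apply/esym; apply: segment_share h h'; exact: gpos.
exists pos, col; split.
  split; last by move=> x y _; exact: straight_curveE.
  split => // x y Gxy; rewrite straight_curveE.
  by apply: segment_arc; exact/pos_neq/Gneq.
move=> F j FG colF.
have childF e : e \in F -> exists x y, child e j x y.
  by move=> eF; rewrite -(colF e eF); exact/childP/FG.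
have child_unique x x' y : child [set x; y]%SET j x y -> child [set x'; y]%SET j x' y -> x = x'.
  by move=> /andP[_ /eqP e] /andP[_ /eqP e']; apply: idx_inj; rewrite -e.
have child_oriented x y : [set x; y]%SET \in F -> (idx x < idx y)%N ->
    child [set x; y]%SET j x y.
  move=> /childF[x' [y' c]] xy; have lt := child_lt _ _ _ _ c.
  have /andP[/eqP/eq_set2[[ex ey]|[ex ey]] _] := c; first by rewrite ex ey in c *.
  by rewrite ex ey ltnNge ltnW in xy.
have parent_unique x x' y : [set x; y]%SET \in F -> [set x'; y]%SET \in F ->
    (idx x < idx y)%N -> (idx x' < idx y)%N -> x = x'.
  by move=> xF xF' xy xy'; apply: (child_unique x x' y); exact: child_oriented.
have edge_oriented e : e \in F -> exists x y, e = [set x; y]%SET /\ (idx x < idx y)%N.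
  by move=> /childF[x [y c]]; exists x, y; split; [case/andP: c => /eqP|exact: child_lt c].
have ncF : noncrossing F pos (straight_curve pos).
  (* Crossing is symmetric, so the edges may be ordered by their later ends; a common later end
     forces equal edges. *)
  suff ord x y x' y' : [set x; y]%SET \in F -> [set x'; y']%SET \in F ->
      (idx x < idx y)%N -> (idx x' < idx y')%N -> (idx y < idx y')%N ->
      edges_cross pos (straight_curve pos) [set x; y]%SET [set x'; y']%SET -> False.
    move=> e f /[dup] eF /edge_oriented[x [y [ee xy]]] /[dup] fF /edge_oriented[x' [y' [ff xy']]].
    rewrite {}ee {}ff in eF fF * => ef.
    have [yy'|yy'|/idx_inj yy'] := ltngtP (idx y) (idx y').
    - exact: ord.
    - move=> [z [h h' nz]]; apply: (ord x' y' x y) => //; exists z; split => //.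
      by move=> [v [v1 v2 v3]]; apply: nz; exists v.
    - rewrite -yy' in ef fF xy' *.
      by rewrite (parent_unique x x' y) ?eqxx in ef.
  move=> xyF xyF' xy xy' yy' [z [+ + nz]]; rewrite !straight_curveE => h h'.
  have neq a b : (idx a < idx b)%N -> a != b by apply: contraTneq => ->; rewrite ltnn.
  have nx : x != y := neq _ _ xy; have nx' : x' != y' := neq _ _ xy'.
  have ny : y != y' := neq _ _ yy'; have nxy' : x != y' := neq _ _ (ltn_trans xy yy').
  have [xx'|xx'] := eqVneq x x'.
    by apply: nz; exists x; rewrite -xx' !set21; split => //; apply: (share x y y'); rewrite // xx'.
  have [yx'|yx'] := eqVneq y x'.
    apply: nz; exists y; split; [exact: set22|by rewrite yx' set21|].
    by apply: (share y x y') => //; [rewrite eq_sym|rewrite segmentC|rewrite yx'].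
  have /andP[_ /eqP b] := child_oriented _ _ xyF xy.
  have /andP[_ /eqP b'] := child_oriented _ _ xyF' xy'.
  have := nc j (idx y) (idx y') (ltn_ord j); rewrite kidx yy' idxN b b'.
  move=> /(_ isT isT)[/idx_inj/eqP|/idx_inj/eqP|ap].
  - by rewrite (negbTE xx').
  - by rewrite (negbTE yx').
  - rewrite segmentC in h; rewrite segmentC in h'.
    by apply: (apart_segments_disjoint ap _ _ h h'); apply: gpos; rewrite // eq_sym.
split => //; first exact: (oriented_forest idx_inj parent_unique).
move=> V FV; apply: outer_drawn_forest; apply: (drawn_forest_oriented (idx := idx)) => //.
- by move=> x y _; exact: straight_curveE.
- by move=> x y z /FG; rewrite mem_edges; exact: avoid.
Qed.

(** * Upper bounds for the four parameters *)

Lemma ex_minimum (P : nat -> Prop) (k t : nat) : P t -> (t <= k)%N ->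
  exists n, is_minimum P n /\ (n <= k)%N.
Proof.
move=> Pt tk; have exP : exists n, `[< P n >] by exists t; apply/asboolP.
case: (ex_minnP exP) => n /asboolP Pn nmin; exists n; split.
  by split => // m Pm; apply: nmin; apply/asboolP.
by apply: leq_trans tk; apply: nmin; apply/asboolP.
Qed.

(** The blocks are the nonempty colour classes, hence at most [k] of them. *)
Lemma ex_coloured_partition (T : finType) (k : nat) (E : {set {set T}})
    (col : {set T} -> 'I_k) :
  exists P, [/\ finset.partition P E, (#|P| <= k)%N &
    forall F, F \in P -> {subset F <= E} /\ exists j, forall e, e \in F -> col e = j].
Proof.
exists (preim_partition col E); split; first exact: preim_partitionP.
  rewrite -[X in (_ <= X)%N]card_ord.
  pose cls j := [set e in E | j == col e]%SET.
  apply: (@leq_trans #|cls @: [set: 'I_k]%SET|).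
    apply: subset_leq_card; apply/fintype.subsetP => F /imsetP[e _ ->].
    by apply/imsetP; exists (col e).
  by rewrite -cardsT; exact: leq_imset_card.
move=> F /imsetP[e eE ->]; split; first by move=> f; rewrite inE => /andP[].
by exists (col e) => f; rewrite inE => /andP[_ /eqP].
Qed.

Lemma set_of_edges_graph (T : finType) (G : sgraph T) (F : {set {set T}}) :
  {subset F <= edges G} -> edges (graph_of_edges F) = F.
Proof.
move=> FG; apply/finset.setP => e; apply/edgesP/idP => [[x [y [/andP[_ xyF] ->]]]//|eF].
have /edgesP[x [y [Gxy exy]]] := FG e eF; exists x, y; split => //.
by rewrite /= /edge_adj -exy eF andbT; apply: contraTneq Gxy => ->; rewrite adj_irrefl.
Qed.

Section UpperBound.
Variables (R : realType) (k : nat) (T : finType) (G : sgraph T).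
Hypotheses (k_gt0 : (0 < k)%N) (tw : treewidth_le k G).

Lemma arboricity_le : exists n, is_arboricity G n /\ (n <= k)%N.
Proof.
have [pos [col [_ H]]] := treewidth_drawing R k_gt0 tw.
have [P [PE cP HP]] := ex_coloured_partition (edges G) col.
apply: ex_minimum cP; exists P; split => // F /HP[FG [j Fj]].
by have [] := H F j FG Fj.
Qed.

Lemma geometric_arboricity_le : exists n, is_geometric_arboricity R G n /\ (n <= k)%N.
Proof.
have [pos [col [D H]]] := treewidth_drawing R k_gt0 tw.
have [P [PE cP HP]] := ex_coloured_partition (edges G) col.
apply: ex_minimum cP; exists pos, (straight_curve pos); split => //.
exists P; split => // F /HP[FG [j Fj]].
by have [] := H F j FG Fj.
Qed.

Lemma geometric_outerthickness_le :
  exists n, is_geometric_outerthickness R G n /\ (n <= k)%N.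
Proof.
have [pos [col [D H]]] := treewidth_drawing R k_gt0 tw.
have [P [PE cP HP]] := ex_coloured_partition (edges G) col.
apply: ex_minimum cP; exists pos, (straight_curve pos); split => //.
exists P; split => // F /HP[FG [j Fj]].
by have [_ ncF oF] := H F j FG Fj; split => //; exact: oF.
Qed.

Lemma outerthickness_le : exists n, is_outerthickness R G n /\ (n <= k)%N.
Proof.
have [pos [col [[[pos_inj arcs avoid] _] H]]] := treewidth_drawing R k_gt0 tw.
have [P [PE cP HP]] := ex_coloured_partition (edges G) col.
apply: ex_minimum cP; exists P; split => // F /HP[FG [j Fj]].
have [_ ncF oF] := H F j FG Fj; exists pos, (straight_curve pos).
have FGadj x y : graph_of_edges F x y -> G x y.
  by move=> /andP[_ /FG]; rewrite mem_edges.
rewrite (set_of_edges_graph FG); split => //; last by apply: oF; exact: finset.subsetT.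
by split => // x y => [|z] /FGadj; [exact: arcs|exact: avoid].
Qed.
End UpperBound.

(** * Lower bounds *)

Lemma arc_compact_connected (R : realType) (a b : plane R) A : is_arc a b A ->
  [/\ compact A, connected A, A a & A b].
Proof.
move=> [g [gc _ g0 g1 ->]]; split.
- by apply: continuous_compact => //; exact: segment_compact.
- by apply: connected_continuous_connected => //; exact: segment_connected.
- by exists 0; rewrite //= in_itv/= lexx ler01.
- by exists 1; rewrite //= in_itv/= lexx ler01.
Qed.

Lemma closed_drawn_points (R : realType) (T : finType) (G : sgraph T) (V : {set T})
    (F : {set {set T}}) (pos : T -> plane R) curve :
  is_drawing G pos curve -> {subset F <= edges G} -> closed (drawn_points V F pos curve).
Proof.
have ccl (A : set (plane R)) : compact A -> closed A.
  by apply: compact_closed; exact: norm_hausdorff.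
move=> [_ arcs _] FG.
have -> : drawn_points V F pos curve =
    \bigcup_(v in [set` V]) [set pos v] `|` \bigcup_(e in [set` F]) curve e.
  apply/seteqP; split => z [[x xV xz]|[x xV xz]]; [left|right|left|right]; exists x => //.
apply: closedU; apply: closed_bigcup; try exact: finite_finset.
- by move=> v _; apply: ccl; exact: compact_set1.
- move=> e /= /FG/edgesP[x [y [Gxy ->]]]; apply: ccl.
  by have [] := arc_compact_connected (arcs x y Gxy).
Qed.

(** For [i != j] the edges from [a] to [p i] and from [b] to [p j] have no common end, so
    noncrossing makes them disjoint, as [no_outer_K23] requires. *)
Lemma outer_no_K23 (R : realType) (T : finType) (G : sgraph T) (V : {set T}) (F : {set {set T}})
    (pos : T -> plane R) curve (a b : T) (p : 'I_3 -> T) :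
  is_drawing G pos curve -> {subset F <= edges G} -> noncrossing F pos curve ->
  outer V F pos curve -> (forall i, p i \in V) -> injective p -> a != b ->
  (forall i, [set a; p i]%SET \in F) -> (forall i, [set b; p i]%SET \in F) -> False.
Proof.
move=> D FG ncF [C [[x nx ->] _] bdV] pV injp ab aF bF.
have [injpos arcs avoid] := D.
have adjF u v : [set u; v]%SET \in F -> G u v by move=> /FG; rewrite mem_edges.
have neqF u v : [set u; v]%SET \in F -> u != v.
  by move=> /adjF; apply: contraTneq => ->; rewrite adj_irrefl.
have sub e : e \in F -> curve e `<=` drawn_points V F pos curve.
  by move=> eF z ez; right; exists e.
apply: (@no_outer_K23 R (pos a) (pos b) (pos \o p) (fun i => curve [set a; p i]%SET)
  (fun i => curve [set b; p i]%SET) (drawn_points V F pos curve) x).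
- move=> i; have [h1 h2 h3 h4] := arc_compact_connected (arcs _ _ (adjF _ _ (aF i))).
  by split => //; exact: sub.
- move=> i; have [h1 h2 h3 h4] := arc_compact_connected (arcs _ _ (adjF _ _ (bF i))).
  by split => //; exact: sub.
- move=> i j ij; apply/seteqP; split => // z [za zb].
  have pij : p i != p j by apply: contra_neq ij; exact: injp.
  have api := neqF _ _ (aF i); have apj := neqF _ _ (aF j).
  have bpi := neqF _ _ (bF i); have bpj := neqF _ _ (bF j).
  apply: (ncF _ _ (aF i) (bF j)).
    apply/eqP => /finset.setP/(_ a); rewrite !inE eqxx (negbTE ab) (negbTE apj) //.
  exists z; split => // -[v []]; rewrite !inE => /orP[]/eqP-> /orP[]/eqP e _.
  + by rewrite e eqxx in ab.
  + by rewrite e eqxx in apj.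
  + by rewrite e eqxx in bpi.
  + by rewrite e eqxx in pij.
- move=> i j ij; have pij : p j <> p i by move=> /injp e; rewrite e eqxx in ij.
  split => [/(avoid _ _ _ (adjF _ _ (aF i)))|/(avoid _ _ _ (adjF _ _ (bF i)))] [e|//].
  + by have := neqF _ _ (aF j); rewrite -e eqxx.
  + by have := neqF _ _ (bF j); rewrite -e eqxx.
- by move=> i j /injpos/injp.
- exact: closed_drawn_points D FG.
- by move=> i; have [] := bdV _ (pV i).
Qed.

Lemma pigeonhole_fibres (I J : finType) (f : I -> J) (S : {set J}) (d : nat) :
  (forall i, f i \in S) -> (#|S| * d < #|I|)%N ->
  exists y, (d < #|[set i | f i == y]|)%N.
Proof.
move=> fS; rewrite ltnNge => /negP h; apply: contrapT => none; apply: h.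
rewrite -[X in (X <= _)%N]sum1_card (partition_big f (mem S)) /=; last by move=> i _; exact: fS.
rewrite -[(#|S| * d)%N]sum_nat_const; apply: leq_sum => y _.
rewrite sum1dep_card leqNgt; apply/negP => h; apply: none; exists y.
by apply: (leq_trans h); apply: subset_leq_card; apply/fintype.subsetP => i; rewrite !inE.
Qed.

(** * Complete bipartite graphs and their partitions *)

Section CompleteBipartite.
Variables k n : nat.

(** For [withK] false this is $K_{k,n}$; for [withK] true the [k] side is also a clique, which gives
    a [k]-tree when [n] is positive. *)
Definition bip_adj (withK : bool) (x y : 'I_k + 'I_n) : bool :=
  match x, y with
  | inl i, inl j => withK && (i != j)
  | inr _, inr _ => false
  | _, _ => true
  end.

Lemma bip_adj_sym withK : symmetric (bip_adj withK).
Proof. by move=> [i|i] [j|j] //=; rewrite eq_sym. Qed.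

Lemma bip_adj_irrefl withK : irreflexive (bip_adj withK).
Proof. by move=> [i|i] //=; rewrite eqxx andbF. Qed.

Definition bip_graph withK := SGraph (bip_adj_sym withK) (bip_adj_irrefl withK).

Let part (m : nat) : {set 'I_k + 'I_n} :=
  [set x : 'I_k + 'I_n | if x is inr j then (j < m)%N else true]%SET.

Let cardL : #|[set x : 'I_k + 'I_n | if x is inr _ then false else true]%SET| = k.
Proof.
rewrite -[RHS]card_ord -(card_imset predT (@inl_inj 'I_k 'I_n)); apply: eq_card => -[i|j].
  by rewrite inE; apply/esym/imsetP; exists i.
by rewrite inE; apply/esym/negbTE/imsetP => -[].
Qed.

(** [part 1] is a clique on [k.+1] vertices, and each further vertex of the [n] side is joined
    exactly to the clique on the [k] side. *)
Lemma bip_ktree m : (m < n)%N -> ktree_on k (bip_graph true) (part m.+1).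
Proof.
have partD m' (h : (m' < n)%N) : (part m'.+1 :\ inr (Ordinal h))%SET = part m'.
  apply/finset.setP => -[i|j]; rewrite !inE //=.
  by rewrite (inj_eq (@inr_inj _ _)) -val_eqE /= ltnS [in RHS]ltn_neqAle.
elim: m => [|m IH] mn.
  apply: ktree_base.
    have := cardsD1 (inr (Ordinal mn)) (part 1); rewrite partD inE /= => ->.
    by rewrite add1n; congr _.+1; rewrite -[RHS]cardL; apply: eq_card => -[i|j]; rewrite !inE.
  move=> [i|i] [j|j]; rewrite !inE //=.
  by rewrite !ltnS !leqn0 => /eqP i0 /eqP j0 /eqP[]; congr inr; apply: val_inj; rewrite /= i0 j0.
have nbE : [set w in part m.+2 | bip_graph true (inr (Ordinal mn)) w]%SET =
    [set x : 'I_k + 'I_n | if x is inr _ then false else true]%SET.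
  by apply/finset.setP => -[i|j]; rewrite !inE //= andbF.
apply: (@ktree_step _ _ _ _ (inr (Ordinal mn))); rewrite ?nbE.
- by rewrite inE /=.
- exact: cardL.
- by move=> [i|i] [j|j]; rewrite !inE.
- by rewrite partD; apply: IH; exact: ltnW.
Qed.

Lemma bip_treewidth : (0 < n)%N -> treewidth_le k (bip_graph false).
Proof.
move=> n0; apply: (@ex_minimum _ k k) => //; exists (bip_graph true); split.
  have partT : [set: 'I_k + 'I_n]%SET = part n.-1.+1.
    by apply/finset.setP => -[i|j]; rewrite !inE //= prednK// ltn_ord.
  by rewrite /is_ktree partT; apply: bip_ktree; rewrite prednK.
by move=> [i|i] [j|j].
Qed.

(** Each vertex of the [n] side has two of its [k] edges in one class. There are at most $k^3$
    choices of two indices and a class, and more than $2k^3$ vertices, so three vertices make the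
    same choice. *)
Lemma monochromatic_K23 (P : {set {set {set ('I_k + 'I_n)}}}) :
  finset.partition P (edges (bip_graph false)) -> (#|P| < k)%N ->
  (k * k * k * 2 < n)%N ->
  exists F i i' (r : 'I_3 -> 'I_n), [/\ F \in P, i != i', injective r,
    forall l, [set inl i; inr (r l)]%SET \in F &
    forall l, [set inl i'; inr (r l)]%SET \in F].
Proof.
move=> PP Pk nk; have [/eqP covP _ _] := and3P PP.
pose e i r : {set 'I_k + 'I_n} := [set inl i; inr r]%SET.
have eE i r : e i r \in finset.cover P by rewrite covP mem_edges.
pose g r i := finset.pblock P (e i r).
have gP r i : g r i \in P by exact: pblock_mem.
have eg r i : e i r \in g r i by rewrite mem_pblock.
have ex_pair r : exists q : 'I_k * 'I_k, (q.1 != q.2) && (g r q.1 == g r q.2).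
  apply: contrapT => none; move: Pk; rewrite ltnNge => /negP; apply.
  have injg : injective (g r).
    move=> i i' gii'; apply/eqP; apply: contraT => ii'; case: none.
    by exists (i, i'); rewrite ii' gii' eqxx.
  rewrite -[X in (X <= _)%N]card_ord -(card_imset predT injg).
  by apply: subset_leq_card; apply/fintype.subsetP => _ /imsetP[i _ ->].
pose q r : 'I_k * 'I_k := xchoose (ex_pair r).
have qP r : ((q r).1 != (q r).2) && (g r (q r).1 == g r (q r).2) := xchooseP (ex_pair r).
pose f r : 'I_k * 'I_k * {set {set 'I_k + 'I_n}} := (q r, g r (q r).1).
have [|| [[i i'] F] large] := @pigeonhole_fibres _ _ f (finset.setX [set: 'I_k * 'I_k]%SET P) 2.
- by move=> r; rewrite inE /= inE gP.
- rewrite card_ord; apply: leq_ltn_trans nk; rewrite cardsX cardsT card_prod card_ord.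
  by rewrite leq_mul2r /= leq_mul2l ltnW ?orbT.
pose r (l : 'I_3) : 'I_n := enum_val (widen_ord large l).
have rP l : f (r l) == ((i, i'), F) by have := enum_valP (widen_ord large l); rewrite inE.
have qr l : q (r l) = (i, i') by have /eqP[] := rP l.
have gr l : g (r l) i = F by have /eqP[_ <-] := rP l; rewrite qr.
have gr' l : g (r l) i' = F by have := qP (r l); rewrite qr /= gr => /andP[_ /eqP].
exists F, i, i', r; split.
- by rewrite -(gr ord0).
- by have := qP (r ord0); rewrite qr => /andP[].
- by move=> l l' /enum_val_inj/(congr1 val) /= h; exact: val_inj.
- by move=> l; rewrite -(gr l); exact: eg.
- by move=> l; rewrite -(gr' l); exact: eg.
Qed.

(** Two of the three vertices [r l] already close a cycle of length 4 with [i] and [i']. *)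
Lemma forest_no_K23 (F : {set {set ('I_k + 'I_n)}}) i i' (r : 'I_3 -> 'I_n) :
  i != i' -> injective r -> (forall l, [set inl i; inr (r l)]%SET \in F) ->
  (forall l, [set inl i'; inr (r l)]%SET \in F) -> ~ is_forest (graph_of_edges F).
Proof.
move=> ii' rinj iF i'F; set r0 := r ord0; set r1 := r ord_max => forF.
have r01 : r0 != r1 by apply/eqP => /rinj/(congr1 val).
suff : (size [:: inl i : 'I_k + 'I_n; inr r0; inl i'; inr r1] <= 2)%N by [].
apply: forF.
  by rewrite /= !inE !(inj_eq (@inl_inj _ _)) !(inj_eq (@inr_inj _ _)) (negbTE ii') (negbTE r01).
by rewrite /= /edge_adj /= ![[set inr _; _]%SET]finset.setUC !iF !i'F.
Qed.
End CompleteBipartite.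

Lemma edges_graph_of_partition (T : finType) (G : sgraph T) P F :
  finset.partition P (edges G) -> F \in P -> {subset F <= edges G}.
Proof.
move=> /and3P[/eqP<- _ _] FP e eF; by apply/bigcupP; exists F.
Qed.

(** * Lower bounds for the four parameters *)

Section LowerBound.
Variables (R : realType) (k : nat).
Let n := (k * k * k * 2).+1.
Let G := bip_graph k n false.

Lemma arboricity_ge t : is_arboricity G t -> (k <= t)%N.
Proof.
move=> [[P [PP <- HP]] _]; rewrite leqNgt; apply/negP => Pk.
have [F [i [i' [r [FP ii' rinj iF i'F]]]]] := monochromatic_K23 PP Pk (leqnn _).
exact: forest_no_K23 ii' rinj iF i'F (HP F FP).
Qed.

Lemma geometric_arboricity_ge t : is_geometric_arboricity R G t -> (k <= t)%N.
Proof.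
move=> [[pos [curve [_ [P [PP <- HP]]]]] _]; rewrite leqNgt; apply/negP => Pk.
have [F [i [i' [r [FP ii' rinj iF i'F]]]]] := monochromatic_K23 PP Pk (leqnn _).
by have [forF _] := HP F FP; exact: forest_no_K23 ii' rinj iF i'F forF.
Qed.

Lemma outerthickness_ge t : is_outerthickness R G t -> (k <= t)%N.
Proof.
move=> [[P [PP <- HP]] _]; rewrite leqNgt; apply/negP => Pk.
have [F [i [i' [r [FP ii' rinj iF i'F]]]]] := monochromatic_K23 PP Pk (leqnn _).
have [pos [curve [D ncF oF]]] := HP F FP.
have FE := set_of_edges_graph (edges_graph_of_partition PP FP).
rewrite FE in ncF oF.
apply: (outer_no_K23 (p := fun l => inr (r l)) D _ ncF oF _ _ _ iF i'F).
- by rewrite FE.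
- by move=> l; rewrite inE.
- by move=> l l' [/rinj].
- by rewrite (inj_eq (@inl_inj _ _)).
Qed.

Lemma geometric_outerthickness_ge t : is_geometric_outerthickness R G t -> (k <= t)%N.
Proof.
move=> [[pos [curve [[D _] [P [PP <- HP]]]]] _]; rewrite leqNgt; apply/negP => Pk.
have [F [i [i' [r [FP ii' rinj iF i'F]]]]] := monochromatic_K23 PP Pk (leqnn _).
have [ncF oF] := HP F FP.
apply: (outer_no_K23 (p := fun l => inr (r l)) D _ ncF oF _ _ _ iF i'F).
- exact: edges_graph_of_partition PP FP.
- by move=> l; apply/bigcupP; exists [set inl i; inr (r l)]%SET; rewrite // set22.
- by move=> l l' [/rinj].
- by rewrite (inj_eq (@inl_inj _ _)).
Qed.
End LowerBound.

(** The upper bound also provides the value on the extremal graph, which the lower bound then forces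
    to be [k]. Uniqueness of the value transfers the bound to any [m] with [is_par]. *)
Lemma max_over_treewidth (k : nat) (is_par : forall T : finType, sgraph T -> nat -> Prop) :
  (forall (T : finType) (G : sgraph T), treewidth_le k G ->
     exists n, is_par T G n /\ (n <= k)%N) ->
  (forall (T : finType) (G : sgraph T) m n, is_par T G m -> is_par T G n -> m = n) ->
  (exists (T : finType) (G : sgraph T), treewidth_le k G /\
     forall n, is_par T G n -> (k <= n)%N) ->
  max_over_treewidth_le k is_par k.
Proof.
move=> ub uniq_par [T [G [tw lb]]]; split; first by move=> T' G' /ub[n []]; exists n.
split => [|m [T' [G' [/ub[n [Pn nk]] Pm]]]]; last by rewrite (uniq_par _ _ _ _ Pm Pn).
have [n [Pn nk]] := ub T G tw; exists T, G; split => //.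
suff -> : k = n by []; by apply/eqP; rewrite eqn_leq nk lb.
Qed.

Lemma is_minimum_unique (P : nat -> Prop) m n : is_minimum P m -> is_minimum P n -> m = n.
Proof.
by move=> [Pm minm] [Pn minn]; apply/eqP; rewrite eqn_leq minm// minn.
Qed.

Theorem theorem2 (R : realType) (k : nat) (hk : (1 <= k)%N) :
  [/\ max_over_treewidth_le k (fun T G => is_arboricity G) k,
      max_over_treewidth_le k (fun T G => is_outerthickness R G) k,
      max_over_treewidth_le k (fun T G => is_geometric_outerthickness R G) k &
      max_over_treewidth_le k (fun T G => is_geometric_arboricity R G) k].
Proof.
pose K := bip_graph k (k * k * k * 2).+1 false.
have tw : treewidth_le k K by exact: bip_treewidth.
split; apply: max_over_treewidth.
- by move=> T G; exact: arboricity_le.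
- by move=> T G m n; exact: is_minimum_unique.
- by exists _, K; split; [exact: tw|exact: arboricity_ge].
- by move=> T G; exact: outerthickness_le.
- by move=> T G m n; exact: is_minimum_unique.
- by exists _, K; split; [exact: tw|exact: outerthickness_ge].
- by move=> T G; exact: geometric_outerthickness_le.
- by move=> T G m n; exact: is_minimum_unique.
- by exists _, K; split; [exact: tw|exact: geometric_outerthickness_ge].
- by move=> T G; exact: geometric_arboricity_le.
- by move=> T G m n; exact: is_minimum_unique.
- by exists _, K; split; [exact: tw|exact: geometric_arboricity_ge].
Qed.
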